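(* Consider the $X_m$ exceptional Jacobi polynomials (one Darboux transformation, codimension $m\in\mathbb{N}$ arbitrary). If $\alpha+\varepsilon_1\ge-\frac12$ and $\beta+\varepsilon_2\ge-\frac12$, then for all $l\in\mathbb{N}$ $$\lim_{n\to\infty}\left(\int Q^l\,d\tilde\nu_n-\int_{-1}^1Q^l\,d\mu_e\right)=0,$$ where $\mu_e$ is the equilibrium measure of $[-1,1]$, $d\mu_e(x)=\frac{dx}{\pi\sqrt{1-x^2}}$, $Q$ is the primitive of $\tilde b$ with zero constant term, and $\tilde\nu_n$ is the normalized counting measure of the $Q$-preimages of the zeros of the modified average characteristic polynomial $\chi_n$.
   Context: Exceptional Jacobi setup (one Darboux transformation). Let $\alpha,\beta>-1$, $w^{(\gamma,\delta)}(x)=(1-x)^\gamma(1+x)^\delta$, $p(x)=1-x^2$, $q(x)=\beta-\alpha-(\alpha+\beta+2)x$, and $T[y]=py''+qy'$. $P_n^{(\gamma,\delta)}$ denotes the Jacobi polynomial defined by Rodrigues' formula $(1-x)^{\gamma}(1+x)^{\delta}P_n^{(\gamma,\delta)}(x)=\frac{(-1)^n}{2^nn!}\left((1-x)^{\gamma+n}(1+x)^{\delta+n}\right)^{(n)}$, and $p_n=P_n^{(\alpha,\beta)}/\varrho_n$ ($\varrho_n>0$) are the orthonormal Jacobi polynomials with respect to $w^{(\alpha,\beta)}$ on $(-1,1)$. Let $\phi$ be one of the following quasi-rational eigenfunctions of $T$, $N\ge 0$ an integer: (i) $(1-x)^{-\alpha}P_N^{(-\alpha,\beta)}(x)$; (ii)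 $(1+x)^{-\beta}P_N^{(\alpha,-\beta)}(x)$; (iii) $(1-x)^{-\alpha}(1+x)^{-\beta}P_N^{(-\alpha,-\beta)}(x)$. Let $\tilde\lambda$ be its eigenvalue, $T\phi=\tilde\lambda\phi$, and let $w=\phi'/\phi$ (a rational function satisfying $p(w'+w^2)+qw=\tilde\lambda$). Let, up to a nonzero constant factor, $b_0$ be respectively $(1-x)P_N^{(-\alpha,\beta)}(x)$, $(1+x)P_N^{(\alpha,-\beta)}(x)$, $(1-x^2)P_N^{(-\alpha,-\beta)}(x)$, and let $b=s\,b_0$, where $s$ is a real polynomial with no zeros on $[-1,1]$. Then $b$ and $bw$ are polynomials. It is assumed that $b$ has no zeros in $(-1,1)$ and that $$b(x)=(1-x)^{\frac{1-\varepsilon_1}{2}}(1+x)^{\frac{1-\varepsilon_2}{2}}\tilde b(x),\qquad \varepsilon_1,\varepsilon_2\in\{-1,1\},$$ with $\tilde b$ a polynomial, $\tilde b>0$ on $[-1,1]$. The exceptional Jacobi polynomials are $P_n^{[1]}=b\,p_n'-bw\,p_n$, $n=0,1,2,\dots$, and the weight is $W=\frac{p\,w^{(\alpha,\beta)}}{b^2}=\frac{w^{(\alpha+\varepsilon_1,\beta+\varepsilon_2)}}{\tilde b^2}$. Standing assumptions: $\{P_n^{[1]}\}_{n\ge0}$ is a complete orthogonal system in $L^2_W(-1,1)$; $P_n^{[1]}(\pm1)\ne0$ for all $n$; and if $b(a)=0$ for $a\in\{-1,1\}$ then $(bw)(a)\neq0$. The codimension of the system is $m=\deg\tilde b$. Finally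 $\sigma_n=\|P_n^{[1]}\|_{W,2}=\left(\int_{-1}^1 (P_n^{[1]})^2W\right)^{1/2}$ and $\hat P_n=P_n^{[1]}/\sigma_n$. Modified average characteristic polynomial. Let $Q(x)=\int_0^x\tilde b$ and $K_n(x,y)=\sum_{k=0}^{n-1}\hat P_k(x)\hat P_k(y)$. Let $\mathbb{E}$ be the expectation with respect to the probability density $\rho_n(x_1,\dots,x_n)=c(n)\det|K_n(x_i,x_j)|_{i,j=1}^n\prod_{i=1}^nW(x_i)$ on $(-1,1)^n$, $c(n)$ being the normalizing constant. Put $\chi_n(z)=\mathbb{E}\left(\prod_{i=1}^n(z-Q(x_i))\right)$, let $z_1,\dots,z_n$ be its zeros (with multiplicity), and let $y_1,\dots,y_n$ be (not necessarily unique, possibly complex) points with $Q(y_i)=z_i$ (if $z_i\in Q([-1,1])$, $y_i$ is chosen in $[-1,1]$). Then $\tilde\nu_n=\frac1n\sum_{i=1}^n\delta_{y_i}$; thus $\int Q^l\,d\tilde\nu_n=\frac1n\sum_{i=1}^n z_i^l$. *)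

(* Defs.v *)
From HB Require Import structures.
From mathcomp Require Import all_boot all_order all_algebra.
From mathcomp Require Import all_classical all_reals all_analysis.
From mathcomp Require Import complex.
Set Implicit Arguments.
Unset Strict Implicit.
Unset Printing Implicit Defensive.
Import Order.TTheory GRing.Theory Num.Theory.
Import numFieldNormedType.Exports.

Local Open Scope classical_set_scope.
Local Open Scope ring_scope.
Local Open Scope complex_scope.

Definition int11 (R : realType) (f : R -> R) : R :=
  \int[lebesgue_measure]_(x in `]-1, 1[) f x.

Definition jacobi_weight (R : realType) (g d x : R) : R :=
  (1 - x) `^ g * (1 + x) `^ d.

(* P is P_n^(g, d), characterized by Rodrigues' formula. No condition is put
   on the real parameters g and d (they may be <= -1); the formula determines
   the polynomial P because the weight does not vanish on (-1, 1). *)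
Definition is_jacobi (R : realType) (g d : R) (n : nat) (P : {poly R}) : Prop :=
  forall x : R, -1 < x < 1 ->
    jacobi_weight g d x * P.[x] =
    (-1) ^+ n / (2 ^+ n * n`!%:R) *
    derive1n n (jacobi_weight (g + n%:R) (d + n%:R)) x.

Definition wnorm (R : realType) (W f : R -> R) : R :=
  Num.sqrt (int11 (fun x => f x ^+ 2 * W x)).

Definition normalize (R : realType) (W : R -> R) (P : {poly R}) : {poly R} :=
  (wnorm W (horner P))^-1 *: P.

Definition in_L2 (R : realType) (W f : R -> R) : Prop :=
  measurable_fun (`]-1, 1[ : set R) f /\
  lebesgue_measure.-integrable `]-1, 1[ (fun x => (f x ^+ 2 * W x)%:E).

(* Pairwise orthogonal nonzero elements of L^2_W(-1, 1) whose linear span is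
   dense in L^2_W(-1, 1). *)
Definition complete_orthogonal_system (R : realType) (W : R -> R)
    (P : nat -> {poly R}) : Prop :=
  [/\ forall n, in_L2 W (horner (P n)),
      forall n, wnorm W (horner (P n)) != 0,
      forall i j, i != j -> int11 (fun x => (P i).[x] * (P j).[x] * W x) = 0
    & forall f : R -> R, in_L2 W f -> forall e : R, 0 < e ->
        exists (n : nat) (c : 'I_n -> R),
          wnorm W (fun x => f x - \sum_(k < n) c k * (P k).[x]) < e].

Definition jacobi_op (R : realType) (a b : R) (y : R -> R) (x : R) : R :=
  (1 - x ^+ 2) * derive1n 2 y x + (b - a - (a + b + 2) * x) * derive1 y x.

(* The three families of quasi-rational seed functions: the exponent is
   flipped at 1, at -1, or at both endpoints. *)
Variant seed := SeedR | SeedL | SeedLR.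

Definition seed_par (R : realType) (k : seed) (a b : R) : R * R :=
  match k with
  | SeedR => (- a, b)
  | SeedL => (a, - b)
  | SeedLR => (- a, - b)
  end.

(* In the next two definitions PN stands for P_N^(g, d) with
   (g, d) = seed_par k a b. *)
Definition seed_fun (R : realType) (k : seed) (a b : R) (PN : {poly R})
    (x : R) : R :=
  match k with
  | SeedR => (1 - x) `^ (- a) * PN.[x]
  | SeedL => (1 + x) `^ (- b) * PN.[x]
  | SeedLR => (1 - x) `^ (- a) * (1 + x) `^ (- b) * PN.[x]
  end.

Definition seed_b0 (R : realType) (k : seed) (PN : {poly R}) : {poly R} :=
  match k with
  | SeedR => (1 - 'X) * PN
  | SeedL => (1 + 'X) * PN
  | SeedLR => (1 - 'X ^+ 2) * PN
  end.

(* b p' - (b w) p for p the n-th orthonormal Jacobi polynomial; bw is the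
   polynomial b w, and P n is P_n^(al, be). *)
Definition xjacobi (R : realType) (al be : R) (P : nat -> {poly R})
    (b bw : {poly R}) (n : nat) : {poly R} :=
  let p := normalize (jacobi_weight al be) (P n) in b * p^`() - bw * p.

(* (1 - e) / 2 for a sign e. *)
Definition half_exp (e : int) : nat := `|((1 - e) %/ 2)%Z|%N.

(* p w^(al, be) / b^2, which is w^(al + e1, be + e2) / bt^2 on (-1, 1) when
   b = (1 - 'X) ^+ half_exp e1 * (1 + 'X) ^+ half_exp e2 * bt. *)
Definition xweight (R : realType) (al be : R) (b : {poly R}) (x : R) : R :=
  (1 - x ^+ 2) * jacobi_weight al be x / b.[x] ^+ 2.

(* Integral over (-1, 1)^n, as an iterated Lebesgue integral. It is only
   applied to finite sums of products of integrable functions of one variable,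
   for which it is the integral against n-dimensional Lebesgue measure
   (Fubini). *)
Fixpoint int11n (R : realType) (n : nat) : (n.-tuple R -> R) -> R :=
  match n with
  | 0 => fun f => f [tuple]
  | n'.+1 => fun f => int11 (fun x => int11n (fun t => f [tuple of x :: t]))
  end.

(* In what follows, X is the sequence of orthogonal polynomials for W. *)
Definition kernel_K (R : realType) (W : R -> R) (X : nat -> {poly R})
    (n : nat) (x y : R) : R :=
  \sum_(k < n) (normalize W (X k)).[x] * (normalize W (X k)).[y].

Definition dpp_weight (R : realType) (W : R -> R) (X : nat -> {poly R})
    (n : nat) (t : n.-tuple R) : R :=
  \det (\matrix_(i < n, j < n) kernel_K W X n (tnth t i) (tnth t j)) *
  \prod_(i < n) W (tnth t i).

Definition dpp_density (R : realType) (W : R -> R) (X : nat -> {poly R})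
    (n : nat) (t : n.-tuple R) : R :=
  (int11n (@dpp_weight R W X n))^-1 * dpp_weight W X t.

Definition expect (R : realType) (W : R -> R) (X : nat -> {poly R})
    (n : nat) (f : n.-tuple R -> R) : R :=
  int11n (fun t => f t * dpp_density W X t).

Definition cexpect (R : realType) (W : R -> R) (X : nat -> {poly R})
    (n : nat) (f : n.-tuple R -> R[i]) : R[i] :=
  expect W X (fun t => complex.Re (f t)) +i* expect W X (fun t => complex.Im (f t)).

Definition mod_avg_charpoly (R : realType) (W : R -> R) (X : nat -> {poly R})
    (Q : {poly R}) (n : nat) (z : R[i]) : R[i] :=
  cexpect W X (fun t : n.-tuple R => \prod_(i < n) (z - (Q.[tnth t i])%:C)).

(* z_1, ..., z_n are all the zeros, listed with multiplicity, of the polynomial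
   function f. *)
Definition zeros_with_mult (R : realType) (f : R[i] -> R[i]) (n : nat)
    (z : 'I_n -> R[i]) : Prop :=
  exists2 c : R[i], c != 0 & forall t, f t = c * \prod_(i < n) (t - z i).

Definition chorner (R : realType) (Q : {poly R}) (z : R[i]) : R[i] :=
  (map_poly (real_complex R) Q).[z].

(* Integral of f against (1/n) \sum_i \delta_(y i). *)
Definition int_counting (R : realType) (n : nat) (y : 'I_n -> R[i])
    (f : R[i] -> R[i]) : R[i] :=
  n%:R^-1 * \sum_(i < n) f (y i).

(* Integral of f against the equilibrium measure of [-1, 1]. *)
Definition int_equilibrium (R : realType) (f : R -> R) : R :=
  int11 (fun x => f x / (pi * Num.sqrt (1 - x ^+ 2))).

(* Main.v *)
Require Import Defs.
From HB Require Import structures.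
From mathcomp Require Import all_boot all_order all_algebra.
From mathcomp Require Import all_classical all_reals all_analysis.
From mathcomp Require Import complex.
From mathcomp Require Import measurable_realfun spectral perm.
From mathcomp Require Import zify ring lra.
Import Order.TTheory GRing.Theory Num.Theory.
Import numFieldNormedType.Exports.
Set Implicit Arguments.
Unset Strict Implicit.
Unset Printing Implicit Defensive.
Local Open Scope classical_set_scope.
Local Open Scope ring_scope.
Local Open Scope complex_scope.

(** Idea of the proof.

Write w for the Jacobi weight, p and q for the coefficients of the Jacobi
operator T = p D^2 + q D, W = p w / b^2 for the exceptional weight, phi_n for
the orthonormal Jacobi polynomials, X_n = b phi_n' - bw phi_n for the exceptional
polynomials and e_n for X_n normalized in L^2_W.

- Expanding the determinant, the average characteristic polynomial chi_n is the
  characteristic polynomial of the n x n matrix M_n with entries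
  [\int Q e_i e_k W] ([mod_avg_charpoly_char_poly], from Andreief's identity).
  The sum of the l-th powers of its zeros is thus the trace of M_n^l
  ([mxtrace_pow_roots]).

- Multiplication by Q is banded in the basis e. Indeed, integrating by parts,
  [\int f X_n X_k W] equals a multiple of [\int f phi_n phi_k w] minus
  [\int f' b phi_n X_k W] ([wint_darboux], which rests on the Riccati equation
  for bw / b). For f = Q the factor Q' = bt makes bt b W a polynomial multiple
  of w, and both integrals vanish by orthogonality of phi_n to polynomials of
  lower degree when n is much larger than k ([darboux_band]). By completeness, M_n
  is then a truncation of an infinite banded matrix, and the trace of M_n^l
  differs from the sum over k < n of [\int Q^l e_k^2 W] by a bounded amount. By
  Cesaro it remains to find the limit of these integrals ([cvg_mean_trace]).

- The same integration by parts with n = k shows that [\int f e_n^2 W] and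
  [\int f phi_n^2 w] have the same limit, the correction being of order 1/n by
  Cauchy-Schwarz ([exceptional_equidistribution]).

- Finally phi_n^2 w tends to the arcsine measure ([jacobi_equidistribution]).
  An energy identity and a Pohozaev identity for the differential equation
  T phi_n = - mu phi_n give [\int (2 p f' + p' f) phi_n^2 w -> 0] for every
  polynomial f ([wint_arcsine_defect]). This is a two-term recursion on the
  limits of moments, the one satisfied by the moments of 1 / (pi sqrt p).

The Jacobi polynomials enter only through their degree and their differential
equation, both extracted from Rodrigues' formula ([size_is_jacobi],
[is_jacobi_eigen]). Most integrals are values
of the functional [wint w] on polynomials, so that after the Pearson identity
[wint_jacobi_Pearson] the arguments are largely algebraic. *)

(** * The fundamental theorem of calculus on an open interval *)

Section OpenIntervalFTC.
Variables (R : realType) (a b : R) (F f : R -> R).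
Hypothesis Ff : forall x, a < x < b -> is_derive x 1 F (f x).
Hypothesis cf : forall x, a < x < b -> {for x, continuous f}.
Notation mu := (@lebesgue_measure R).

Let within_cf c d : a < c -> d < b -> {within `[c, d], continuous f}.
Proof.
move=> ac db; apply: continuous_in_subspaceT => x.
rewrite inE/= in_itv/= => /andP[cx xd]; apply: cf.
by rewrite (lt_le_trans ac cx) (le_lt_trans xd db).
Qed.

Let dF x : a < x < b -> derivable F x 1.
Proof. by move=> /Ff Dx; apply: ex_derive. Qed.

Let cF x : a < x < b -> {for x, continuous F}.
Proof.
by move=> /dF dFx; apply/differentiable_continuous/derivable1_diffP.
Qed.

Lemma FTC_inner c d : a < c -> c < d -> d < b ->
  (\int[mu]_(x in `[c, d]) (f x)%:E = (F d - F c)%:E)%E.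
Proof.
move=> ac cd db; rewrite EFinB; apply: continuous_FTC2 => //.
- exact: within_cf.
- split.
  + move=> x; rewrite in_itv/= => /andP[cx xd]; apply: dF.
    by rewrite (lt_trans ac cx) (lt_trans xd db).
  + by apply: cvg_at_right_filter; apply: cF; rewrite ac (lt_trans cd).
  + by apply: cvg_at_left_filter; apply: cF; rewrite db (lt_trans ac).
- move=> x; rewrite in_itv/= => /andP[cx xd]; rewrite derive1E.
  have xab : a < x < b by rewrite (lt_trans ac cx) (lt_trans xd db).
  by have Dx := Ff xab; rewrite derive_val.
Qed.

Let mf : measurable_fun `]a, b[ f.
Proof.
apply: open_continuous_measurable_fun; first exact: interval_open.
by move=> x; rewrite inE/= in_itv/=; exact: cf.
Qed.

(** For a derivative that is merely integrable on the open interval: the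
primitive of f based at a and F differ by a constant inside, and both have
one-sided limits at the ends. *)
Lemma FTC_oo A B : a < b -> mu.-integrable `]a, b[ (EFin \o f) ->
  F x @[x --> a^'+] --> A -> F x @[x --> b^'-] --> B ->
  \int[mu]_(x in `]a, b[) f x = B - A.
Proof.
move=> ab fi FA FB.
have mfcc : measurable_fun `[a, b] f.
  by apply/measurable_fun_itv_bndo_bndcP/measurable_fun_itv_obnd_cbndP.
have fi' : mu.-integrable `]a, b] (EFin \o f).
  apply/integrableP; split; first by apply/measurable_EFinP/measurable_fun_itv_bndo_bndcP.
  move: fi => /integrableP[_]; rewrite integral_itv_bndo_bndc//.
  by apply/measurable_EFinP; apply: measurableT_comp.
have fcc : mu.-integrable `[a, b] (EFin \o f).
  apply/integrableP; split; first by apply/measurable_EFinP.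
  move: fi' => /integrableP[_]; rewrite integral_itv_obnd_cbnd//.
  apply/measurable_EFinP; apply: measurableT_comp => //.
  exact/measurable_fun_itv_bndo_bndcP.
rewrite Rintegral_itv_bndo_bndc// Rintegral_itv_obnd_cbnd//.
pose G := parameterized_integral mu a ^~ f.
have G0 : G x @[x --> a^'+] --> (0 : R).
  by apply: cvg_at_right_filter; apply: parameterized_integral_cvg_left fcc.
have G1 : G x @[x --> b^'-] --> G b.
  exact: parameterized_integral_cvg_at_left.
have GF c d : a < c -> c < d -> d < b -> G d - G c = F d - F c.
  move=> ac cd db; rewrite /G /parameterized_integral.
  have sub : `[a, d] `<=` `[a, b].
    by move=> x /=; rewrite !in_itv/= => /andP[-> xd]; rewrite (le_trans xd)// ltW.
  rewrite Rintegral_itvB ?bnd_simp ?ltW//; last exact: integrableS fcc.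
  rewrite Rintegral_itv_obnd_cbnd; last first.
    apply: integrableS fcc => // x /=; rewrite !in_itv/= => /andP[cx xd].
    by rewrite (ltW (lt_trans ac cx)) (le_trans xd)// ltW.
  by rewrite /Rintegral FTC_inner.
have GFA d : a < d -> d < b -> G d = F d - A.
  move=> ad db.
  have : (G d - G c) @[c --> a^'+] --> G d - 0 by apply: cvgB => //; apply: cvg_cst.
  rewrite subr0 => H1.
  have H2 : (F d - F c) @[c --> a^'+] --> F d - A.
    by apply: cvgB => //; apply: cvg_cst.
  have H3 : (G d - G c) @[c --> a^'+] --> F d - A.
    apply: cvg_trans H2; apply: near_eq_cvg; near=> c.
    apply/esym/GF => //.
  exact: (cvg_unique _ H1 H3).
have G2 : G x @[x --> b^'-] --> B - A.
  have H2 : (F x - A) @[x --> b^'-] --> B - A.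
    by apply: cvgB => //; apply: cvg_cst.
  apply: cvg_trans H2; apply: near_eq_cvg; near=> c.
  by apply/esym/GFA.
exact: (cvg_unique _ G1 G2).
Unshelve. all: by end_near. Qed.

(** The integrals over an exhausting sequence of compact intervals are bounded
by the oscillation of the primitive, and increase to the integral. *)
Lemma ge0_integrable_oo (C : R) : a < b -> (forall x, a < x < b -> 0 <= f x) ->
  (forall x, a < x < b -> `|F x| <= C) -> mu.-integrable `]a, b[ (EFin \o f).
Proof.
move=> ab f0 FC.
apply/integrableP; split; first exact/measurable_EFinP.
(* d n < (b - a) / 2 keeps the intervals [a + d n, b - d n] nonempty *)
pose d n : R := (b - a) / 2 / n.+2%:R.
have d0 n : 0 < d n by rewrite /d divr_gt0// divr_gt0// subr_gt0.
have dlt n : d n < (b - a) / 2.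
  by rewrite /d ltr_pdivrMr// ltr_pMr ?ltr1n// divr_gt0// subr_gt0.
pose E n := (`[a + d n, b - d n]%classic : set R).
have EU : \bigcup_n E n = `]a, b[%classic.
  apply/seteqP; split=> [x [n _]|x] /=; rewrite /E/= !in_itv/=.
    by have := d0 n; move=> d0n /andP[H1 H2]; apply/andP; split; lra.
  move=> /andP[ax xb].
  have m0 : 0 < Num.min (x - a) (b - x) by rewrite lt_min !subr_gt0 ax.
  have [n Hn] : exists n, d n < Num.min (x - a) (b - x).
    exists (Num.truncn ((b - a) / 2 / Num.min (x - a) (b - x))).
    rewrite /d ltr_pdivrMr// [ltRHS]mulrC -ltr_pdivrMr//.
    by apply: lt_trans (Num.Theory.truncnS_gt _) _; rewrite ltr_nat.
  exists n => //=; rewrite in_itv/=; move: Hn; rewrite lt_min => /andP[H1 H2].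
  by apply/andP; split; lra.
have := @ge0_nondecreasing_set_cvg_integral _ (measurableTypeR R) R E (EFin \o f)
  (@lebesgue_measure R).
rewrite EU => cv.
have -> : (\int[mu]_(x in `]a, b[) `|(EFin \o f) x| =
           \int[mu]_(x in `]a, b[) (EFin \o f) x)%E.
  apply: eq_integral => x; rewrite inE/= in_itv/= => xab.
  by rewrite ger0_norm// f0.
suff : (\int[mu]_(x in `]a, b[) (EFin \o f) x <= (C + C)%:E)%E.
  by move=> /le_lt_trans; apply; rewrite ltry.
have sub n x : E n x -> a < x < b.
  move=> Enx; suff : (`]a, b[%classic : set R) x by rewrite /= in_itv.
  by rewrite -EU; exists n.
apply: (cvge_to_le (cv _ _ _ _)).
- apply/nondecreasing_seqP => n; apply/subsetPset => x; rewrite /E/= !in_itv/=.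
  have : d n.+1 <= d n.
    rewrite /d ler_pM2l ?divr_gt0 ?subr_gt0// lef_pV2 ?posrE// ler_nat//.
  by move=> H /andP[H1 H2]; apply/andP; split; lra.
- by move=> n; exact: measurable_itv.
- move=> n; apply/measurable_EFinP; apply: measurable_funS mf => //.
  by move=> x /sub; rewrite /= in_itv.
- by move=> n x /sub ?; rewrite lee_fin f0.
- apply: nearW => n /=.
  have := d0 n; have := dlt n => H1 H2.
  rewrite FTC_inner; [|lra|lra|lra].
  rewrite lee_fin.
  have := FC (a + d n); have := FC (b - d n); rewrite !ler_norml.
  move=> /(_ _)/andP[|_ K1]; first by apply/andP; split; lra.
  move=> /(_ _)/andP[|K2 _]; first by apply/andP; split; lra.
  lra.
Unshelve. all: by end_near. Qed.

End OpenIntervalFTC.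

(** * Jacobi weights *)

Section JacobiWeight.
Variable R : realType.
Implicit Types (g d x : R) (h : R -> R).

Lemma is_derive_1BpowR g x : x < 1 ->
  is_derive x 1 (fun t : R => (1 - t) `^ g) (- (g * (1 - x) `^ (g - 1))).
Proof.
move=> x1; have x0 : 0 < 1 - x by rewrite subr_gt0.
have D1 : is_derive x 1 (fun t : R => 1 - t) (- 1).
  have -> : (-1 : R) = 0 - 1 by rewrite sub0r.
  exact: is_deriveB.
have D2 := is_derive1_powR g x0.
have := @is_derive1_comp _ (fun y => y `^ g) (fun t : R => 1 - t) x _ _ D2 D1.
by rewrite /comp /= mulrN1.
Qed.

Lemma is_derive_1DpowR g x : -1 < x ->
  is_derive x 1 (fun t : R => (1 + t) `^ g) (g * (1 + x) `^ (g - 1)).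
Proof.
move=> x1; have x0 : 0 < 1 + x by lra.
have D1 : is_derive x 1 (fun t : R => 1 + t) 1.
  rewrite -[X in is_derive _ _ _ X]add0r; exact: is_deriveD.
have D2 := is_derive1_powR g x0.
have := @is_derive1_comp _ (fun y => y `^ g) (fun t : R => 1 + t) x _ _ D2 D1.
by rewrite /comp /= mulr1.
Qed.

Lemma jacobi_weight_shift g d (i j : nat) x : -1 < x < 1 ->
  jacobi_weight (g + i%:R) (d + j%:R) x =
  (1 - x) ^+ i * (1 + x) ^+ j * jacobi_weight g d x.
Proof.
move=> /andP[x1 x2]; rewrite /jacobi_weight !powRD; last 2 first.
- by apply/implyP => _; apply: lt0r_neq0; lra.
- by apply/implyP => _; apply: lt0r_neq0; lra.
rewrite !powR_mulrn; [ring|lra|lra].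
Qed.

Lemma is_derive_jacobi_weight g d x : -1 < x < 1 ->
  is_derive x 1 (jacobi_weight (g + 1) (d + 1))
    ((d - g - (g + d + 2) * x) * jacobi_weight g d x).
Proof.
move=> /andP[x1 x2].
have D1 := is_derive_1BpowR (g + 1) x2.
have D2 := is_derive_1DpowR (d + 1) x1.
have D := @is_deriveM _ _ _ _ _ _ _ _ D1 D2.
apply: is_derive_eq; rewrite /jacobi_weight /GRing.scale /=.
rewrite -!(addrA _ 1 (-1)) subrr !addr0 !powRD; last 2 first.
- by apply/implyP => _; apply: lt0r_neq0; lra.
- by apply/implyP => _; apply: lt0r_neq0; lra.
rewrite !powRr1; [ring|lra|lra].
Qed.

End JacobiWeight.

Section JacobiWeightIntegral.
Variable R : realType.
Implicit Types (g d x : R) (h : R -> R).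
Notation mu := (@lebesgue_measure R).

Lemma jacobi_weight_ge0 g d x : 0 <= jacobi_weight g d x.
Proof. by rewrite mulr_ge0 ?powR_ge0. Qed.

Lemma continuous_jacobi_weight g d x : -1 < x < 1 ->
  {for x, continuous (jacobi_weight g d)}.
Proof.
move=> x11; apply/differentiable_continuous/derivable1_diffP.
have := is_derive_jacobi_weight (g - 1) (d - 1) x11.
by rewrite !subrK => D; apply: ex_derive.
Qed.

Lemma powR_le_base12 (t d : R) : 1 <= t -> t <= 2 -> t `^ d <= 1 + 2 `^ d.
Proof.
move=> t1 t2; have [d0|d0] := leP 0 d.
  apply: (@le_trans _ _ (2 `^ d)); last by rewrite lerDr.
  by apply: ge0_ler_powR; rewrite ?nnegrE; lra.
apply: (@le_trans _ _ (t `^ 0)); first by apply: ler_powR => //; apply: ltW.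
by rewrite powRr0 lerDl powR_ge0.
Qed.

(** Each factor is bounded on the half of the interval away from its own
endpoint. *)
Lemma jacobi_weight_le g d x : -1 < x < 1 ->
  jacobi_weight g d x <=
  (1 + 2 `^ d) * (1 - x) `^ g + (1 + 2 `^ g) * (1 + x) `^ d.
Proof.
move=> /andP[x1 x2]; rewrite /jacobi_weight.
have pg := powR_ge0 (1 - x) g; have pd := powR_ge0 (1 + x) d.
have p2g := powR_ge0 2 g; have p2d := powR_ge0 2 d.
have [x0|x0] := leP 0 x.
  have H : (1 + x) `^ d <= 1 + 2 `^ d by apply: powR_le_base12; lra.
  by apply: ler_wpDr; [nra|rewrite mulrC ler_wpM2r].
have H : (1 - x) `^ g <= 1 + 2 `^ g by apply: powR_le_base12; lra.
by apply: ler_wpDl; [nra|rewrite ler_wpM2r].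
Qed.

Lemma integrable_1BpowR g : -1 < g ->
  mu.-integrable `](-1), 1[ (EFin \o (fun x => (1 - x) `^ g)).
Proof.
move=> g1.
apply: (@ge0_integrable_oo _ _ _ (fun x => - (g + 1)^-1 * (1 - x) `^ (g + 1)) _
  _ _ ((g + 1)^-1 * 2 `^ (g + 1))) => //.
- move=> x /andP[x1 x2]; have D := is_derive_1BpowR (g + 1) x2.
  have := @is_deriveZ _ _ _ _ (- (g + 1)^-1) _ _ _ D.
  have -> : (fun t : R => - (g + 1)^-1 * (1 - t) `^ (g + 1)) =
    (- (g + 1)^-1) \*: (fun t => (1 - t) `^ (g + 1)) by [].
  rewrite /GRing.scale /= addrK => {}D; apply: is_derive_eq.
  by rewrite mulrNN mulrA mulVf ?mul1r//; apply: lt0r_neq0; lra.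
- move=> x /andP[x1 x2]; apply/differentiable_continuous/derivable1_diffP.
  by have D := is_derive_1BpowR g x2; apply: ex_derive.
- by move=> x _; exact: powR_ge0.
- move=> x /andP[x1 x2]; rewrite normrM normrN normfV (@gtr0_norm _ (g + 1)); last by lra.
  apply: ler_wpM2l; first by rewrite invr_ge0; lra.
  rewrite ger0_norm ?powR_ge0//; apply: ge0_ler_powR; rewrite ?nnegrE; lra.
Qed.

Lemma integrable_1DpowR d : -1 < d ->
  mu.-integrable `](-1), 1[ (EFin \o (fun x => (1 + x) `^ d)).
Proof.
move=> d1.
apply: (@ge0_integrable_oo _ _ _ (fun x => (d + 1)^-1 * (1 + x) `^ (d + 1)) _
  _ _ ((d + 1)^-1 * 2 `^ (d + 1))) => //.
- move=> x /andP[x1 x2]; have D := is_derive_1DpowR (d + 1) x1.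
  have := @is_deriveZ _ _ _ _ ((d + 1)^-1) _ _ _ D.
  have -> : (fun t : R => (d + 1)^-1 * (1 + t) `^ (d + 1)) =
    ((d + 1)^-1) \*: (fun t => (1 + t) `^ (d + 1)) by [].
  rewrite /GRing.scale /= addrK => {}D; apply: is_derive_eq.
  by rewrite mulrA mulVf ?mul1r//; apply: lt0r_neq0; lra.
- move=> x /andP[x1 x2]; apply/differentiable_continuous/derivable1_diffP.
  by have D := is_derive_1DpowR d x1; apply: ex_derive.
- by move=> x _; exact: powR_ge0.
- move=> x /andP[x1 x2]; rewrite normrM normfV (@gtr0_norm _ (d + 1)); last by lra.
  apply: ler_wpM2l; first by rewrite invr_ge0; lra.
  rewrite ger0_norm ?powR_ge0//; apply: ge0_ler_powR; rewrite ?nnegrE; lra.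
Qed.

Lemma measurable_oo h : (forall x, -1 < x < 1 -> {for x, continuous h}) ->
  measurable_fun (`](-1), 1[ : set R) h.
Proof.
move=> ch; apply: open_continuous_measurable_fun; first exact: interval_open.
by move=> x; rewrite inE/= in_itv/=; exact: ch.
Qed.

Lemma integrable_jacobi_weight g d : -1 < g -> -1 < d ->
  mu.-integrable `](-1), 1[ (EFin \o jacobi_weight g d).
Proof.
move=> g1 d1.
have mI : measurable (`](-1), 1[%classic : set (measurableTypeR R)) by exact: measurable_itv.
have := integrableD mI
  (integrableZl mI (1 + 2 `^ d) (integrable_1BpowR g1))
  (integrableZl mI (1 + 2 `^ g) (integrable_1DpowR d1)).
apply: (le_integrable mI).
  apply/measurable_EFinP; apply: measurable_oo => x.
  exact: continuous_jacobi_weight.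
move=> x /=; rewrite in_itv/= => x11.
rewrite lee_fin ger0_norm ?jacobi_weight_ge0// ger0_norm.
  exact: jacobi_weight_le.
by rewrite addr_ge0// mulr_ge0 ?powR_ge0// addr_ge0 ?powR_ge0.
Qed.

(** The boundary terms of all the integrations by parts below vanish by this
squeeze. *)
Lemma cvg0_bounded_jacobi_weight g d h (C : R) : 0 < g -> 0 < d ->
  (forall x, -1 < x < 1 -> `|h x| <= C) ->
  h x * jacobi_weight g d x @[x --> 1^'-] --> (0 : R) /\
  h x * jacobi_weight g d x @[x --> (-1)^'+] --> (0 : R).
Proof.
move=> g0 d0 hC.
have C0 : 0 <= C by apply: le_trans (hC 0 _); rewrite ?normr_ge0 ?ltrN10 ?ltr01.
have small (r e : R) : 0 < r -> 0 < e -> exists2 a, 0 < a &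
    forall t, 0 <= t -> t < a -> t `^ r < e.
  move=> r0 e0; exists (e `^ r^-1); first exact: powR_gt0.
  move=> t t0 ta; have -> : e = (e `^ r^-1) `^ r.
    by rewrite -powRrM mulVf ?powRr1 ?ltW// gt_eqF.
  by apply: gt0_ltr_powR => //; rewrite nnegrE ?powR_ge0.
have bnd r t : 0 < r -> 0 <= t -> t <= 2 -> t `^ r <= 2 `^ r.
  by move=> r0 t0 t2; apply: ge0_ler_powR; rewrite ?nnegrE; lra.
split; apply/cvgrPdist_lt => e e0.
- have ed0 : 0 < e / (C + 1) / 2 `^ d by rewrite !divr_gt0 ?powR_gt0 ?ltr_wpDl.
  have [a a0 Ha] := small g _ g0 ed0.
  near=> x.
  have x11 : -1 < x < 1 by apply/andP; split; near: x;
    [apply: nbhs_left_gt; lra|exact: nbhs_left_lt].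
  rewrite sub0r normrN normrM [X in _ * X]ger0_norm ?jacobi_weight_ge0//.
  have K : (1 - x) `^ g < e / (C + 1) / 2 `^ d.
    apply: Ha; first by lra.
    have : 1 - a < x by near: x; apply: nbhs_left_gt; lra.
    by lra.
  rewrite /jacobi_weight.
  apply: (@le_lt_trans _ _ ((C + 1) * ((1 - x) `^ g * 2 `^ d))).
    apply: ler_pM => //.
    + by rewrite mulr_ge0 ?powR_ge0.
    + by apply: le_trans (hC _ x11) _; lra.
    + by apply: ler_wpM2l; [exact: powR_ge0|apply: bnd => //; lra].
  rewrite mulrC -ltr_pdivlMr ?ltr_wpDl//.
  by rewrite -ltr_pdivlMr// powR_gt0.
- have ed0 : 0 < e / (C + 1) / 2 `^ g by rewrite !divr_gt0 ?powR_gt0 ?ltr_wpDl.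
  have [a a0 Ha] := small d _ d0 ed0.
  near=> x.
  have x11 : -1 < x < 1 by apply/andP; split; near: x;
    [exact: nbhs_right_gt|apply: nbhs_right_lt; lra].
  rewrite sub0r normrN normrM [X in _ * X]ger0_norm ?jacobi_weight_ge0//.
  have K : (1 + x) `^ d < e / (C + 1) / 2 `^ g.
    apply: Ha; first by lra.
    have : x < a - 1 by near: x; apply: nbhs_right_lt; lra.
    by lra.
  rewrite /jacobi_weight.
  apply: (@le_lt_trans _ _ ((C + 1) * (2 `^ g * (1 + x) `^ d))).
    apply: ler_pM => //.
    + by rewrite mulr_ge0 ?powR_ge0.
    + by apply: le_trans (hC _ x11) _; lra.
    + by apply: ler_wpM2r; [exact: powR_ge0|apply: bnd => //; lra].
  rewrite mulrC -ltr_pdivlMr ?ltr_wpDl// [X in X < _]mulrC.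
  by rewrite -ltr_pdivlMr// powR_gt0.
Unshelve. all: by end_near. Qed.

End JacobiWeightIntegral.

(** * Integration of polynomials against a weight *)

Section WeightedIntegral.
Variable R : realType.
Notation mu := (@lebesgue_measure R).

Definition oo_integrable (f : R -> R) : Prop :=
  mu.-integrable `](-1), 1[ (EFin \o f).

Let mI : measurable (`](-1), 1[%classic : set (measurableTypeR R)).
Proof. exact: measurable_itv. Qed.

Lemma oo_integrableD (f g : R -> R) : oo_integrable f -> oo_integrable g ->
  oo_integrable (fun x => f x + g x).
Proof. exact: integrableD. Qed.

Lemma oo_integrableZ (c : R) (f : R -> R) : oo_integrable f ->
  oo_integrable (fun x => c * f x).
Proof. exact: integrableZl. Qed.

Lemma int11D (f g : R -> R) : oo_integrable f -> oo_integrable g ->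
  int11 (fun x => f x + g x) = int11 f + int11 g.
Proof. exact: RintegralD. Qed.

Lemma int11Z (c : R) (f : R -> R) : oo_integrable f ->
  int11 (fun x => c * f x) = c * int11 f.
Proof. exact: RintegralZl. Qed.

Lemma eq_int11 (f g : R -> R) : (forall x, -1 < x < 1 -> f x = g x) ->
  int11 f = int11 g.
Proof.
by move=> fg; apply: eq_Rintegral => x; rewrite inE/= in_itv/=; exact: fg.
Qed.

Lemma int11_ge0 (f : R -> R) : (forall x, -1 < x < 1 -> 0 <= f x) -> 0 <= int11 f.
Proof.
by move=> f0; apply: Rintegral_ge0 => x /=; rewrite in_itv/=; exact: f0.
Qed.

Lemma eq_oo_integrable (f g : R -> R) : (forall x, -1 < x < 1 -> f x = g x) ->
  oo_integrable f -> oo_integrable g.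
Proof.
move=> fg; apply: eq_integrable => // x; rewrite inE/= in_itv/= => x11.
by rewrite fg.
Qed.

Lemma le_oo_integrable (f g : R -> R) : (forall x, -1 < x < 1 -> {for x, continuous f}) ->
  (forall x, -1 < x < 1 -> `|f x| <= g x) -> oo_integrable g -> oo_integrable f.
Proof.
move=> cf fg; apply: le_integrable => //.
  by apply/measurable_EFinP; exact: measurable_oo.
move=> x /=; rewrite in_itv/= => x11.
by rewrite lee_fin (le_trans (fg _ x11))// ler_norm.
Qed.

(** The weights for which integration against polynomials is a positive
linear functional. *)
Definition admissible_weight (w : R -> R) : Prop :=
  [/\ forall x, -1 < x < 1 -> {for x, continuous w},
      forall x, -1 < x < 1 -> 0 <= w x & oo_integrable w].

Lemma admissible_jacobi_weight (g d : R) : -1 < g -> -1 < d ->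
  admissible_weight (jacobi_weight g d).
Proof.
move=> g1 d1; split=> [x|x _|].
- exact: continuous_jacobi_weight.
- exact: jacobi_weight_ge0.
- exact: integrable_jacobi_weight.
Qed.

Lemma horner_bounded (p : {poly R}) : exists2 C : R, 0 <= C &
  forall x : R, -1 <= x <= 1 -> `|p.[x]| <= C.
Proof.
exists (\sum_(i < size p) `|p`_i|) => [|x x11]; first exact: sumr_ge0.
rewrite horner_coef (le_trans (ler_norm_sum _ _ _))// ler_sum// => i _.
rewrite normrM ler_piMr// normrX exprn_ile1//.
by rewrite ler_norml.
Qed.

Definition wint (w : R -> R) (g : {poly R}) : R := int11 (fun x => g.[x] * w x).

Lemma continuous_horner_at (g : {poly R}) (x : R) :
  {for x, continuous (horner g)}.
Proof. exact: continuous_horner. Qed.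

Section Functional.
Variable w : R -> R.
Hypothesis aw : admissible_weight w.
Implicit Types f g h X Y : {poly R}.

Lemma wintable g : oo_integrable (fun x => g.[x] * w x).
Proof.
case: aw => cw w0 iw; have [C C0 HC] := horner_bounded g.
apply: (@le_oo_integrable _ (fun x => C * w x)).
- move=> x x11; apply: continuousM; [exact: continuous_horner_at|exact: cw].
- move=> x x11; rewrite normrM (ger0_norm (w0 _ x11)) ler_wpM2r ?w0//.
  by apply: HC; case/andP: x11 => *; rewrite !ltW.
- exact: oo_integrableZ.
Qed.

Lemma wintD g h : wint w (g + h) = wint w g + wint w h.
Proof.
rewrite /wint -int11D; try exact: wintable.
by apply: eq_int11 => x _; rewrite hornerD mulrDl.
Qed.

Lemma wintZ c g : wint w (c *: g) = c * wint w g.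
Proof.
rewrite /wint -int11Z; last exact: wintable.
by apply: eq_int11 => x _; rewrite hornerZ mulrA.
Qed.

Lemma wint0 : wint w 0 = 0.
Proof. by rewrite -(scale0r 0) wintZ mul0r. Qed.

Lemma wintN g : wint w (- g) = - wint w g.
Proof. by rewrite -scaleN1r wintZ mulN1r. Qed.

Lemma wintB g h : wint w (g - h) = wint w g - wint w h.
Proof. by rewrite wintD wintN. Qed.

Lemma wint_sum (I : Type) (r : seq I) (P : pred I) (g : I -> {poly R}) :
  wint w (\sum_(i <- r | P i) g i) = \sum_(i <- r | P i) wint w (g i).
Proof. by apply: (big_morph _ wintD wint0). Qed.

Lemma wint_ge0 g : (forall x : R, -1 < x < 1 -> 0 <= g.[x]) -> 0 <= wint w g.
Proof.
move=> g0; apply: int11_ge0 => x x11; apply: mulr_ge0; first exact: g0.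
by case: aw => _ w0 _; exact: w0.
Qed.

Lemma wint_sqr_ge0 g : 0 <= wint w (g ^+ 2).
Proof. by apply: wint_ge0 => x _; rewrite horner_exp sqr_ge0. Qed.

Lemma wint_le g h : (forall x : R, -1 < x < 1 -> g.[x] <= h.[x]) ->
  wint w g <= wint w h.
Proof.
move=> gh; rewrite -subr_ge0 -wintB; apply: wint_ge0 => x x11.
by rewrite hornerD hornerN subr_ge0 gh.
Qed.

(** Cauchy-Schwarz with a bounded multiplier, by the discriminant of a
quadratic form which is nonnegative because |f| <= C. *)
Lemma wint_CauchySchwarz f X Y (C : R) : 0 <= C ->
  (forall x : R, -1 < x < 1 -> `|f.[x]| <= C) ->
  wint w (f * X * Y) ^+ 2 <= C ^+ 2 * wint w (X ^+ 2) * wint w (Y ^+ 2).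
Proof.
move=> C0 fC.
pose A := wint w (X ^+ 2); pose B := wint w (f * X * Y).
pose D := wint w (Y ^+ 2).
have A0 : 0 <= A by exact: wint_sqr_ge0.
have D0 : 0 <= D by exact: wint_sqr_ge0.
have H t : 0 <= C * A + 2 * t * B + t ^+ 2 * (C * D).
  have -> : C * A + 2 * t * B + t ^+ 2 * (C * D) =
      wint w (C *: X ^+ 2 + (2 * t) *: (f * X * Y) + (t ^+ 2 * C) *: Y ^+ 2).
    by rewrite !wintD !wintZ mulrA.
  apply: wint_ge0 => x x11; have := fC _ x11; rewrite ler_norml => /andP[f1 f2].
  rewrite !(hornerD, hornerZ, horner_exp, hornerM).
  set a := X.[x]; set b := Y.[x]; set c := f.[x] in f1 f2 *.
  have e1 : 0 <= (C + c) * (a + t * b) ^+ 2.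
    by rewrite mulr_ge0 ?sqr_ge0//; lra.
  have e2 : 0 <= (C - c) * (a - t * b) ^+ 2.
    by rewrite mulr_ge0 ?sqr_ge0//; lra.
  rewrite [leRHS](_ : _ =
     ((C + c) * (a + t * b) ^+ 2 + (C - c) * (a - t * b) ^+ 2) / 2); last by field.
  by rewrite divr_ge0// addr_ge0.
rewrite -/A -/B -/D.
have [CD0|CD0] := eqVneq (C * D) 0.
  have B0 : B = 0.
    apply/eqP; apply/negPn/negP => Bn0.
    have := H (- (C * A + 1) / (2 * B)).
    rewrite CD0 mulr0 addr0.
    have -> : 2 * (- (C * A + 1) / (2 * B)) * B = - (C * A + 1).
      by field.
    by lra.
  by rewrite B0 expr0n/= -mulrA mulr_ge0// ?sqr_ge0// mulr_ge0.
have CDp : 0 < C * D by rewrite lt0r CD0 mulr_ge0.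
have /andP[Cn0 Dn0] : (C != 0) && (D != 0) by rewrite -negb_or -mulf_eq0.
have := H (- B / (C * D)).
have -> : C * A + 2 * (- B / (C * D)) * B + (- B / (C * D)) ^+ 2 * (C * D) =
  (C * A * (C * D) - B ^+ 2) / (C * D) by field; rewrite Cn0 Dn0.
rewrite pmulr_lge0 ?invr_gt0// subr_ge0 => /le_trans; apply.
by rewrite [leLHS](_ : _ = C ^+ 2 * A * D)//; ring.
Qed.

Lemma wint_null g h : wint w (g ^+ 2) = 0 -> wint w (g * h) = 0.
Proof.
move=> g0; apply/eqP; rewrite -sqrf_eq0 eq_le sqr_ge0 andbT.
have := @wint_CauchySchwarz 1 g h 1 ler01; rewrite mul1r g0 mulr0 mul0r; apply.
by move=> x _; rewrite hornerC normr1.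
Qed.

End Functional.

(** The coefficients of the Jacobi operator T = p D^2 + q D. *)
Definition jac_p : {poly R} := 1 - 'X^2.
Definition jac_q (a b : R) : {poly R} := (b - a)%:P - (a + b + 2) *: 'X.

Lemma horner_jac_p x : jac_p.[x] = 1 - x ^+ 2.
Proof. by rewrite /jac_p !hornerE expr2. Qed.

Lemma horner_jac_q a b x : (jac_q a b).[x] = b - a - (a + b + 2) * x.
Proof. by rewrite /jac_q !hornerE. Qed.

(** Integration by parts against the Jacobi weight: [(p w g)' = w (p g' + q g)]
and p w vanishes at both ends. *)
Lemma wint_jacobi_Pearson (a b : R) (g : {poly R}) : -1 < a -> -1 < b ->
  wint (jacobi_weight a b) (jac_p * g^`() + jac_q a b * g) = 0.
Proof.
move=> a1 b1.
have aw := admissible_jacobi_weight a1 b1.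
pose F x := g.[x] * jacobi_weight (a + 1) (b + 1) x.
have [C C0 HC] := horner_bounded g.
have [|||F1 F2] := @cvg0_bounded_jacobi_weight R (a + 1) (b + 1) (horner g) C.
- by lra.
- by lra.
- by move=> x /andP[x1 x2]; apply: HC; rewrite !ltW.
rewrite -[RHS](subrr 0).
apply: (@FTC_oo _ _ _ F) => //.
- move=> x x11.
  have D1 := is_derive_jacobi_weight a b x11.
  have D2 := is_derive_poly g x.
  have D := is_deriveM D2 D1; apply: is_derive_eq.
  rewrite /GRing.scale /= -[a + 1]/(a + 1%:R) -[b + 1]/(b + 1%:R).
  rewrite jacobi_weight_shift// hornerD !hornerM horner_jac_p horner_jac_q.
  by rewrite !expr1; ring.
- move=> x x11; apply: continuousM; first exact: continuous_horner_at.
  exact: continuous_jacobi_weight.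
- exact: wintable.
Qed.

End WeightedIntegral.

(** * The Jacobi differential equation *)

Section JacobiEquation.
Variable R : realType.
Implicit Types (a b x y : R) (f g h P : {poly R}).

Lemma poly_eq_on_sequence (F : idomainType) (v : nat -> F) (f g : {poly F}) :
  injective v -> (forall i, f.[v i] = g.[v i]) -> f = g.
Proof.
move=> vI fg; apply/eqP; rewrite -subr_eq0; apply/negPn/negP => n0.
pose s := [seq v i | i <- iota 0 (size (f - g))].
have := @max_poly_roots _ (f - g) s n0; rewrite size_map size_iota ltnn => H.
suff: false by []; apply: H; last by rewrite map_inj_uniq ?iota_uniq.
by apply/allP => _ /mapP[i _ ->]; rewrite rootE hornerD hornerN fg subrr.
Qed.

Lemma poly_eq_oo f g : (forall x : R, -1 < x < 1 -> f.[x] = g.[x]) -> f = g.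
Proof.
move=> fg; apply: (@poly_eq_on_sequence _ (fun i => (i.+2%:R)^-1 : R)) => [i j|i].
  by move=> /invr_inj/eqP; rewrite eqr_nat => /eqP[].
apply: fg; apply/andP; split; first by apply: lt_trans (ltrN10 _) _; rewrite invr_gt0.
by rewrite invf_lt1// ltr1n.
Qed.

Lemma deriv_Xn n : ('X^n)^`() = n%:R *: 'X^(n.-1) :> {poly R}.
Proof. by rewrite derivXn scaler_nat. Qed.

Definition jac_op a b g : {poly R} := jac_p R * g^`()^`() + jac_q a b * g^`().

(** Minus the eigenvalue of the Jacobi operator on degree n. *)
Definition jac_eig a b (n : nat) : R := n%:R * (n%:R + a + b + 1).

(** D^n w^(a+n, b+n) divided by w^(a, b), computed by differentiating the
innermost factor first. *)
Fixpoint rodrigues (n : nat) a b : {poly R} :=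
  if n is n'.+1 then
    let G := rodrigues n' (a + 1) (b + 1) in jac_p R * G^`() + jac_q a b * G
  else 1.

Lemma deriv_jac_p : (jac_p R)^`() = - (2 *: 'X).
Proof. by rewrite /jac_p derivB derivC derivXn sub0r -scaler_nat. Qed.

Lemma deriv_jac_q a b : (jac_q a b)^`() = - (a + b + 2)%:P.
Proof. by rewrite /jac_q derivB derivC derivZ derivX sub0r alg_polyC. Qed.

Lemma jac_q_shift a b : jac_q (a + 1) (b + 1) = jac_q a b + (jac_p R)^`().
Proof.
rewrite deriv_jac_p /jac_q; apply/polyP => i.
by rewrite !coefE; case: (i == 0)%N; case: (i == 1)%N => /=; ring.
Qed.

(** One differentiation maps eigenfunctions of T_(a+1, b+1) to eigenfunctions
of T_(a, b): if G1 = p G' + q G then G1' = T_(a+1, b+1) G + q' G is a multiple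
of G, hence T_(a, b) G1 = p G1'' + q G1' is the same multiple of G1. *)
Lemma jac_op_rodrigues n a b :
  jac_op a b (rodrigues n a b) = - jac_eig a b n *: rodrigues n a b.
Proof.
elim: n a b => [|n IHn] a b /=.
  by rewrite /jac_op /jac_eig derivC deriv0 !mulr0 mul0r oppr0 scale0r addr0.
set G := rodrigues n _ _.
have D : (jac_p R * G^`() + jac_q a b * G)^`() = - jac_eig a b n.+1 *: G.
  transitivity (jac_op (a + 1) (b + 1) G + (jac_q a b)^`() * G).
    by rewrite derivD !derivM /jac_op jac_q_shift; ring.
  rewrite IHn -/G deriv_jac_q -polyCN mul_polyC -scalerDl; congr (_ *: _).
  by rewrite /jac_eig -natr1; ring.
rewrite /jac_op D derivZ -!scalerAr -scalerDr; congr (_ *: _).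
Qed.

Lemma size_rodrigues n a b : (size (rodrigues n a b) <= n.+1)%N.
Proof.
elim: n a b => [|n IHn] a b /=; first by rewrite size_poly1.
set G := rodrigues n _ _; have sG : (size G <= n.+1)%N := IHn _ _.
have sG' : (size G^`() <= n)%N.
  have [->|G0] := eqVneq G 0; first by rewrite deriv0 size_poly0.
  by rewrite -ltnS (leq_trans (lt_size_deriv G0)).
have sp : (size (jac_p R) <= 3)%N.
  rewrite /jac_p (leq_trans (size_polyD _ _))// geq_max size_poly1.
  by rewrite size_polyN size_polyXn.
have sq : (size (jac_q a b) <= 2)%N.
  rewrite /jac_q (leq_trans (size_polyD _ _))// geq_max size_polyN.
  rewrite (leq_trans (size_polyC_leq1 _))//.
  by rewrite (leq_trans (size_scale_leq _ _))// size_polyX.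
rewrite (leq_trans (size_polyD _ _))// geq_max; apply/andP; split.
  rewrite (leq_trans (size_polyMleq _ _))//.
  by rewrite (@leq_trans (3 + n).-1)// -!subn1 leq_sub2r// leq_add.
rewrite (leq_trans (size_polyMleq _ _))//.
by rewrite (@leq_trans (2 + n.+1).-1)// -!subn1 leq_sub2r// leq_add.
Qed.

Lemma near_oo (x : R) (Q : R -> Prop) : -1 < x < 1 ->
  (forall y : R, -1 < y < 1 -> Q y) -> \near x, Q x.
Proof.
move=> /andP[x1 x2] H.
have : \forall y \near x, y \in `](-1), 1[.
  by apply: near_in_itvoo; rewrite in_itv/= x1.
by apply: filterS => y; rewrite in_itv/=; exact: H.
Qed.

Lemma derive1n_jacobi_weight n a b x : -1 < x < 1 ->
  derive1n n (jacobi_weight (a + n%:R) (b + n%:R)) x =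
  jacobi_weight a b x * (rodrigues n a b).[x].
Proof.
elim: n a b x => [|n IHn] a b x x11.
  by rewrite /= !addr0 hornerC mulr1.
rewrite [rodrigues n.+1 a b]/=; set G := rodrigues n _ _.
have E : forall y : R, -1 < y < 1 ->
    derive1n n (jacobi_weight (a + n.+1%:R) (b + n.+1%:R)) y =
    jacobi_weight (a + 1) (b + 1) y * G.[y].
  by move=> y y11; rewrite -IHn// -!addrA !nat1r.
rewrite derive1nS derive1E.
rewrite (@near_eq_derive R R^o R^o _ _ x 1 (near_oo x11 E)).
have D1 := is_derive_jacobi_weight a b x11.
have D2 := is_derive_poly G x.
have D := is_deriveM D1 D2; rewrite derive_val.
rewrite /GRing.scale /= -[a + 1]/(a + 1%:R) -[b + 1]/(b + 1%:R).
by rewrite jacobi_weight_shift// hornerD !hornerM horner_jac_p horner_jac_q; ring.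
Qed.

Lemma jacobi_weight_gt0 a b x : -1 < x < 1 -> 0 < jacobi_weight a b x.
Proof. by move=> /andP[x1 x2]; rewrite mulr_gt0// powR_gt0//; lra. Qed.

Lemma is_jacobi_rodrigues a b n P : is_jacobi a b n P ->
  P = ((-1) ^+ n / (2 ^+ n * n`!%:R)) *: rodrigues n a b.
Proof.
move=> HP; apply: poly_eq_oo => x x11.
have w0 := jacobi_weight_gt0 a b x11.
apply: (mulfI (lt0r_neq0 w0)); rewrite HP// derive1n_jacobi_weight// hornerZ.
ring.
Qed.

Lemma jac_opZ a b c g : jac_op a b (c *: g) = c *: jac_op a b g.
Proof. by rewrite /jac_op !derivZ -!scalerAr scalerDr. Qed.

Lemma is_jacobi_eigen a b n P : is_jacobi a b n P ->
  jac_op a b P = - jac_eig a b n *: P.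
Proof.
move=> /is_jacobi_rodrigues ->.
by rewrite jac_opZ jac_op_rodrigues !scalerA mulrC.
Qed.

Lemma size_is_jacobi a b n P : is_jacobi a b n P -> (size P <= n.+1)%N.
Proof.
move=> /is_jacobi_rodrigues ->.
by rewrite (leq_trans (size_scale_leq _ _))// size_rodrigues.
Qed.

End JacobiEquation.

(** * Orthogonality, energy and Pohozaev identities *)

Section JacobiOrthogonality.
Variables (R : realType) (a b : R).
Hypotheses (a1 : -1 < a) (b1 : -1 < b).
Implicit Types (f g h : {poly R}).
Notation L := (wint (jacobi_weight a b)).
Notation T := (jac_op a b).
Notation p := (jac_p R).
Notation q := (jac_q a b).
Let aw := admissible_jacobi_weight a1 b1.

Lemma wint_jac_op g h : L (T g * h) = - L (p * g^`() * h^`()).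
Proof.
apply/eqP; rewrite -addr_eq0 -wintD//; apply/eqP.
rewrite -[RHS](wint_jacobi_Pearson (g^`() * h) a1 b1); congr wint.
by rewrite /jac_op derivM; ring.
Qed.

Lemma wint_jac_op_sym g h : L (T g * h) = L (g * T h).
Proof.
by rewrite [in RHS]mulrC !wint_jac_op; congr (- _); congr wint; ring.
Qed.

Lemma jac_op_Xn (d : nat) : T 'X^d =
  - jac_eig a b d *: 'X^d + ((b - a) * d%:R) *: 'X^(d.-1)
  + (d%:R * d.-1%:R) *: 'X^(d.-2).
Proof.
case: d => [|[|d]].
- by rewrite /jac_op derivC deriv0 /jac_eig !mulr0 !mul0r oppr0 !scale0r !addr0.
- rewrite /jac_op /= derivX derivC mulr0 add0r mulr1 /jac_q /jac_eig.
  rewrite !mulr0 scale0r addr0 mulr1 expr0 alg_polyC scaleNr addrC.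
  by congr (- (_ *: _) + _); ring.
- rewrite /jac_op deriv_Xn derivZ deriv_Xn !succnK.
  rewrite /jac_p /jac_q /jac_eig -!natr1.
  have -> : 'X^(d.+2) = 'X * 'X * 'X^d :> {poly R} by rewrite !exprS mulrA.
  have -> : 'X^(d.+1) = 'X * 'X^d :> {poly R} by rewrite exprS.
  have -> : 'X^2 = 'X * 'X :> {poly R} by rewrite expr2.
  rewrite -!mul_polyC !(polyCM, polyCD, polyCN).
  have -> : (1 : R)%:P = 1 by [].
  ring.
Qed.

Lemma jac_eig_lt (i j : nat) : (i < j)%N -> jac_eig a b i < jac_eig a b j.
Proof.
move=> ij; rewrite -subr_gt0.
have -> : jac_eig a b j - jac_eig a b i =
    (j%:R - i%:R) * (j%:R + i%:R + a + b + 1) by rewrite /jac_eig; ring.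
have j0 : 1 <= j%:R :> R by rewrite ler1n (leq_ltn_trans _ ij).
have i0 : 0 <= i%:R :> R by exact: ler0n.
apply: mulr_gt0; first by rewrite subr_gt0 ltr_nat.
by move: (a1) (b1) => ? ?; lra.
Qed.

(** By induction on d: T is symmetric for L, and triangular on monomials with
distinct eigenvalues. *)
Lemma jac_eigen_orth_Xn n g (d : nat) : T g = - jac_eig a b n *: g ->
  (d < n)%N -> L (g * 'X^d) = 0.
Proof.
move=> Tg; elim/ltn_ind: d => d IHd dn.
have := wint_jac_op_sym g 'X^d.
rewrite Tg jac_op_Xn !mulrDr -!scalerAl -!scalerAr !wintD// !wintZ//.
have E1 : (b - a) * d%:R * L (g * 'X^(d.-1)) = 0.
  case: d IHd dn => [|d] IHd dn; first by rewrite mulr0 mul0r.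
  by rewrite IHd ?mulr0//= ltnW.
have E2 : d%:R * d.-1%:R * L (g * 'X^(d.-2)) = 0.
  case: d IHd dn {E1} => [|[|d]] IHd dn; rewrite ?mulr0 ?mul0r//.
  by rewrite IHd ?mulr0//= ltnW// ltnW.
rewrite E1 E2 !addr0 !mulNr => /oppr_inj H; apply/eqP.
have : (jac_eig a b n - jac_eig a b d) * L (g * 'X^d) == 0.
  by rewrite mulrBl H subrr.
by rewrite mulf_eq0 subr_eq0 gt_eqF ?jac_eig_lt.
Qed.

Lemma jac_eigen_orth n g h : T g = - jac_eig a b n *: g ->
  (size h <= n)%N -> L (g * h) = 0.
Proof.
move=> Tg hn; rewrite -[h]coefK poly_def mulr_sumr wint_sum//.
apply: big1 => i _; rewrite -scalerAr wintZ// (jac_eigen_orth_Xn Tg) ?mulr0//.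
exact: leq_trans hn.
Qed.

(** Two comparisons of the measures [f phi^2 w] and [f p phi'^2 w] for a
normalized eigenfunction phi. Testing the equation against [f phi] shows that
the second is about mu times the first. Testing it against [f p phi'], a
Pohozaev identity, relates the second for [p f' + p' f - q f] exactly to the
first for [p f' + q f]. Together, [2 p f' + p' f] is asymptotically annihilated
by [phi^2 w], as it is by the equilibrium measure. *)
Section Eigen.
Variables (phi : {poly R}) (mu : R).
Hypothesis Tphi : T phi = - mu *: phi.
Hypothesis phi1 : L (phi ^+ 2) = 1.

Lemma wint_energy : L (p * phi^`() ^+ 2) = mu.
Proof.
have := wint_jac_op phi phi; rewrite Tphi -scalerAl wintZ// -expr2 phi1 mulr1.
by move=> /oppr_inj ->; congr wint; ring.
Qed.

Lemma eigen_ge0 : 0 <= mu.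
Proof.
rewrite -wint_energy; apply: wint_ge0 => // x /andP[x1 x2].
rewrite hornerM horner_jac_p horner_exp mulr_ge0 ?sqr_ge0//.
nra.
Qed.

Lemma wint_p_sqr_le1 : L (p * phi ^+ 2) <= 1.
Proof.
rewrite -phi1; apply: wint_le => // x _.
by rewrite hornerM horner_jac_p ler_piMl ?horner_exp ?sqr_ge0// gerBl sqr_ge0.
Qed.

Lemma wint_energy_local f : L (f * (p * phi^`() ^+ 2)) =
  mu * L (f * phi ^+ 2) - L (f^`() * p * phi * phi^`()).
Proof.
have := wint_jac_op phi (f * phi); rewrite Tphi -scalerAl wintZ// derivM.
have -> : phi * (f * phi) = f * phi ^+ 2 by ring.
have -> : p * phi^`() * (f^`() * phi + f * phi^`()) =
  f^`() * p * phi * phi^`() + f * (p * phi^`() ^+ 2) by ring.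
rewrite wintD//; set x := L _; set y := L _; set z := L _ => H.
by rewrite -[mu * x]opprK -mulNr H; ring.
Qed.

Lemma wint_Pohozaev f :
  L ((p * f^`() + p^`() * f - q * f) * (p * phi^`() ^+ 2)) =
  - mu * L ((p * f^`() + q * f) * phi ^+ 2).
Proof.
have P1 := wint_jacobi_Pearson (f * phi ^+ 2) a1 b1.
have P2 := wint_jacobi_Pearson (f * (p * phi^`() ^+ 2)) a1 b1.
have E1 : p * (f * phi ^+ 2)^`() + q * (f * phi ^+ 2) =
   (p * f^`() + q * f) * phi ^+ 2 + 2%:R *: (f * p * phi * phi^`()).
  by rewrite derivM expr2 derivM scaler_nat; ring.
have E2 : p * (f * (p * phi^`() ^+ 2))^`() + q * (f * (p * phi^`() ^+ 2)) =
   (p * f^`() + p^`() * f - q * f) * (p * phi^`() ^+ 2)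
   - 2%:R *: (mu *: (f * p * phi * phi^`())).
  transitivity ((p * f^`() + p^`() * f - q * f) * (p * phi^`() ^+ 2) +
     2%:R *: (f * p * phi^`() * T phi)); last first.
    by rewrite Tphi !scaler_nat -!mul_polyC polyCN; ring.
  by rewrite /jac_op scaler_nat expr2 !derivM; ring.
rewrite E1 wintD// wintZ// in P1.
rewrite E2 wintB// !wintZ// in P2.
move: P1 P2; set A := L _; set K := L _; set B := L _ => P1 P2.
have -> : A = - (2 * K) by lra.
by lra.
Qed.

Lemma wint_shift g : L (p * g) = wint (jacobi_weight (a + 1) (b + 1)) g.
Proof.
apply: eq_int11 => x x11; rewrite -[a + 1]/(a + 1%:R) -[b + 1]/(b + 1%:R).
by rewrite jacobi_weight_shift// hornerM horner_jac_p; ring.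
Qed.

Lemma wint_cross_bound f (C : R) : 0 <= C ->
  (forall x : R, -1 < x < 1 -> `|f.[x]| <= C) ->
  L (f * p * phi * phi^`()) ^+ 2 <= C ^+ 2 * mu.
Proof.
move=> C0 fC.
have a2 : -1 < a + 1 by rewrite ltr_wpDr.
have b2 : -1 < b + 1 by rewrite ltr_wpDr.
have -> : f * p * phi * phi^`() = p * (f * phi * phi^`()) by ring.
rewrite wint_shift.
apply: (le_trans (wint_CauchySchwarz (admissible_jacobi_weight a2 b2) _ _ C0 fC)).
rewrite -!wint_shift wint_energy -mulrA ler_wpM2l ?sqr_ge0//.
by rewrite ler_piMl ?eigen_ge0// wint_p_sqr_le1.
Qed.

Lemma wint_arcsine_defect f (C : R) : 0 <= C ->
  (forall x : R, -1 < x < 1 ->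
     `|(p * f^`() + p^`() * f - q * f)^`().[x]| <= C) ->
  mu * L ((2%:R *: (p * f^`()) + p^`() * f) * phi ^+ 2) ^+ 2 <= C ^+ 2.
Proof.
move=> C0; set h := _ + _ - _ => hC.
have H1 := wint_energy_local h; have H2 := wint_Pohozaev f.
rewrite -/h in H2; rewrite H2 in H1.
have := wint_cross_bound C0 hC.
have -> : L (h^`() * p * phi * phi^`()) =
    mu * L ((2%:R *: (p * f^`()) + p^`() * f) * phi ^+ 2).
  have -> : (2%:R *: (p * f^`()) + p^`() * f) * phi ^+ 2 =
     (p * f^`() + q * f) * phi ^+ 2 + h * phi ^+ 2.
    by rewrite -mul_polyC /h; ring.
  rewrite wintD// [RHS]mulrDr -[LHS](subKr (mu * L (h * phi ^+ 2))) -H1.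
  by ring.
set X := L _ => H.
have := eigen_ge0; rewrite le_eqVlt => /predU1P[<-|mu0].
  by rewrite mul0r sqr_ge0.
by rewrite -(ler_pM2r mu0); apply: le_trans H; rewrite le_eqVlt; apply/orP; left; apply/eqP; ring.
Qed.
End Eigen.
End JacobiOrthogonality.

Section Equilibrium.
Variable R : realType.
Implicit Types f g : {poly R}.
Notation we := (jacobi_weight (- (1 / 2)) (- (1 / 2) : R)).

Lemma half_gtN1 : -1 < - (1 / 2) :> R.
Proof. by lra. Qed.

Lemma equilibrium_weightE (x : R) : -1 < x < 1 -> we x = (Num.sqrt (1 - x ^+ 2))^-1.
Proof.
move=> /andP[x1 x2]; rewrite /jacobi_weight !powRN div1r !powR12_sqrt; try lra.
rewrite -invfM -sqrtrM; last by lra.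
by congr (Num.sqrt _)^-1; ring.
Qed.

Lemma int_equilibriumE f :
  int_equilibrium (horner f) = pi^-1 * wint we f.
Proof.
have aw := admissible_jacobi_weight half_gtN1 half_gtN1.
rewrite /wint -int11Z; last exact: wintable.
apply: eq_int11 => x x11; rewrite equilibrium_weightE// invfM.
by ring.
Qed.

Lemma cvg_asin1 : @asin R x @[x --> 1^'-] --> pi / 2.
Proof.
apply/cvgrPdist_lt => e e0.
have pi0 := pi_gt0 R.
pose t : R := pi / 2 - Num.min (e / 2) (pi / 2).
have tt : 0 <= t < pi / 2 /\ pi / 2 - t < e.
  rewrite /t; have [H|H] := leP (e / 2) (pi / 2); split; lra.
move: t tt => t [/andP[t1 t2] t3].
have ti : t \in `[(- (pi / 2)), pi / 2].
  by rewrite in_itv/=; apply/andP; split; lra.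
have pi_i : pi / 2 \in `[(- (pi / 2)), pi / 2 : R].
  by rewrite in_itv/=; apply/andP; split; lra.
have sint : sin t < 1 by have := ltr_sin ti pi_i; rewrite sin_pihalf => ->.
near=> x.
have tx : sin t < x by near: x; exact: nbhs_left_gt.
have x11 : -1 < x < 1 by apply/andP; split; near: x;
    [apply: nbhs_left_gt; lra|exact: nbhs_left_lt].
have x11' : -1 <= x <= 1 by case/andP: x11 => *; rewrite !ltW.
have ai : asin x \in `[(- (pi / 2)), pi / 2].
  by rewrite in_itv/= asin_geNpi2 ?asin_lepi2.
rewrite ger0_norm ?subr_ge0 ?asin_lepi2//.
suff : t < asin x by lra.
by rewrite -(ltr_sin ti ai) asinK// in_itv.
Unshelve. all: by end_near. Qed.

(** The total mass of the arcsine density, with the arcsine as primitive. *)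
Lemma wint_equilibrium1 : wint we 1 = pi.
Proof.
have aw := admissible_jacobi_weight half_gtN1 half_gtN1.
have -> : pi = pi / 2 - - (pi / 2) :> R by field.
apply: (@FTC_oo _ _ _ (@asin R)).
- move=> x x11; have D := is_derive1_asin x11; apply: is_derive_eq.
  by rewrite hornerC mul1r equilibrium_weightE.
- move=> x x11; apply: continuousM; first exact: continuous_horner_at.
  exact: continuous_jacobi_weight.
- by lra.
- exact: wintable.
- apply/cvg_at_rightNP; rewrite opprK.
  have /cvgN := cvg_asin1; apply: cvg_trans; apply: near_eq_cvg; near=> x.
  have x11 : -1 <= x <= 1 by apply/andP; split; apply: ltW; near: x;
    [apply: nbhs_left_gt; lra|exact: nbhs_left_lt].
  rewrite /= -[in RHS](asinK (x := x)) ?in_itv//= -sinN sinK// in_itv/=.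
  by rewrite lerN2 lerNl asin_geNpi2// asin_lepi2.
- exact: cvg_asin1.
Unshelve. all: by end_near. Qed.
End Equilibrium.

(** * Equidistribution of the squares of Jacobi polynomials *)

Section JacobiEquidistribution.
Variables (R : realType) (a b : R).
Hypotheses (a1 : -1 < a) (b1 : -1 < b).
Implicit Types (f g : {poly R}).
Notation L := (wint (jacobi_weight a b)).
Notation p := (jac_p R).
Let aw := admissible_jacobi_weight a1 b1.
Variable phi : nat -> {poly R}.
Hypothesis Tphi : forall n, jac_op a b (phi n) = - jac_eig a b n *: phi n.
Hypothesis phi1 : forall n, L (phi n ^+ 2) = 1.

Lemma le_jac_eig (n : nat) : (1 < n)%N -> n%:R <= jac_eig a b n.
Proof.
move=> n1; have n2 : 2 <= n%:R :> R by rewrite ler_nat.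
move: a1 b1 => a1' b1'; rewrite /jac_eig ler_peMr ?ler0n//; lra.
Qed.

Lemma cvg0_of_eig (u : nat -> R) (C lam : R) :
  (forall n, (jac_eig a b n + lam) * u n ^+ 2 <= C ^+ 2) ->
  u n @[n --> \oo] --> (0 : R).
Proof.
move=> uC; apply/cvgrPdist_lt => e e0; near=> n.
have n1 : (1 < n)%N by near: n; exact: nbhs_infty_gt.
have n0 : - lam < n%:R by near: n; exact: nbhs_infty_gtr.
have nC : C ^+ 2 / e ^+ 2 - lam < n%:R by near: n; exact: nbhs_infty_gtr.
rewrite sub0r normrN -(ltr_pXn2r (n := 2)) ?nnegrE ?(ltW e0)//.
rewrite real_normK ?num_real//.
have nl0 : 0 < n%:R + lam by lra.
rewrite -(ltr_pM2l nl0).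
apply: (@le_lt_trans _ _ (C ^+ 2)).
  apply: le_trans (uC n); apply: ler_wpM2r; first exact: sqr_ge0.
  by rewrite lerD2r le_jac_eig.
by rewrite -ltr_pdivrMr ?exprn_gt0// -ltrBlDr.
Unshelve. all: by end_near. Qed.

(** The primitive of [arcsine_test f / (2 sqrt p)] is [sqrt p f], which vanishes
at both ends: this is the functional equation that characterizes the arcsine
measure among probability measures. *)
Definition arcsine_test f := 2%:R *: (p * f^`()) + p^`() * f.

Lemma cvg_arcsine_test f :
  L (arcsine_test f * phi n ^+ 2) @[n --> \oo] --> (0 : R).
Proof.
set h := (p * f^`() + p^`() * f - jac_q a b * f)^`().
have [C C0 HC] := horner_bounded h.
apply: (@cvg0_of_eig _ C 0) => n; rewrite addr0.
apply: (wint_arcsine_defect a1 b1 (Tphi n) (phi1 n) C0) => x /andP[x1 x2].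
by apply: HC; rewrite !ltW.
Qed.

Lemma int_equilibrium_arcsine_test f : int_equilibrium (horner (arcsine_test f)) = 0.
Proof.
have h1 : -1 < - (1 / 2) :> R by exact: half_gtN1.
have := wint_jacobi_Pearson f h1 h1; rewrite int_equilibriumE.
have -> : p * f^`() + jac_q (- (1 / 2)) (- (1 / 2)) * f = 2^-1 *: arcsine_test f.
  rewrite /arcsine_test scalerDr scalerA mulVf// scale1r deriv_jac_p /jac_q.
  congr (_ + _); rewrite mulNr -scalerAl scalerN scalerA mulVf// scale1r.
  rewrite subrr sub0r mulNr; congr (- (_ * _)).
  by rewrite [X in X *: _](_ : _ = 1) ?scale1r//; lra.
rewrite wintZ; last exact: admissible_jacobi_weight.
by move=> /eqP; rewrite mulf_eq0 invr_eq0 pnatr_eq0/= => /eqP ->; rewrite mulr0.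
Qed.

Lemma Xn_arcsine_test (j : nat) : 'X^(j.+1) =
  (j%:R / j.+1%:R) *: 'X^(j.-1) - (2 * j.+1%:R)^-1 *: arcsine_test 'X^j :> {poly R}.
Proof.
have j0 : j.+1%:R != 0 :> R by rewrite pnatr_eq0.
apply: (scalerI j0); rewrite scalerBr !scalerA.
have -> : j.+1%:R / (2 * j.+1%:R) = 2^-1 :> R by field; rewrite addrC natr1.
have -> : j.+1%:R * (j%:R / j.+1%:R) = j%:R :> R by field; rewrite addrC natr1.
rewrite /arcsine_test deriv_jac_p deriv_Xn scalerDr scalerA mulVf// scale1r.
rewrite mulNr -scalerAl scalerN scalerA mulVf// scale1r -exprS.
rewrite -scalerAr /jac_p mulrBl mul1r scalerBr -natr1 scalerDl scale1r.
case: j {j0} => [|j]; first by rewrite !scale0r; ring.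
rewrite succnK -exprD add2n; ring.
Qed.

(** The squares of the orthonormal eigenfunctions equidistribute to the
arcsine measure: both sides satisfy the recursion of [Xn_arcsine_test], up to
a vanishing error, and agree on constants. *)
Lemma cvg_wint_Xn (j : nat) :
  L ('X^j * phi n ^+ 2) @[n --> \oo] --> int_equilibrium (horner ('X^j : {poly R})).
Proof.
have h1 : -1 < - (1 / 2) :> R by exact: half_gtN1.
have aE := admissible_jacobi_weight h1 h1.
elim/ltn_ind: j => -[_|j IHj].
  rewrite int_equilibriumE expr0 wint_equilibrium1 mulVf ?gt_eqF ?pi_gt0//.
  rewrite (_ : (fun n => _) = cst 1); first exact: cvg_cst.
  by apply/funext => n; rewrite mul1r phi1.
have E g c h d : int_equilibrium (horner (c *: g - d *: h)) =
    c * int_equilibrium (horner g) - d * int_equilibrium (horner h).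
  by rewrite !int_equilibriumE wintB// !wintZ//; ring.
rewrite Xn_arcsine_test E int_equilibrium_arcsine_test.
have -> : (fun n => L ((j%:R / j.+1%:R *: 'X^(j.-1) -
      (2 * j.+1%:R)^-1 *: arcsine_test 'X^j) * phi n ^+ 2)) =
   (fun n => j%:R / j.+1%:R * L ('X^(j.-1) * phi n ^+ 2) -
      (2 * j.+1%:R)^-1 * L (arcsine_test 'X^j * phi n ^+ 2)).
  by apply/funext => n; rewrite mulrBl -[_ *: 'X^_ * _]scalerAl
    -[_ *: arcsine_test _ * _]scalerAl wintB// !wintZ.
apply: cvgB; apply: cvgM; [exact: cvg_cst| |exact: cvg_cst|exact: cvg_arcsine_test].
by apply: IHj; case: (j).
Qed.

Theorem jacobi_equidistribution f :
  L (f * phi n ^+ 2) @[n --> \oo] --> int_equilibrium (horner f).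
Proof.
have h1 : -1 < - (1 / 2) :> R by exact: half_gtN1.
have aE := admissible_jacobi_weight h1 h1.
rewrite -[f]coefK poly_def int_equilibriumE wint_sum// mulr_sumr.
have -> : (fun n => L ((\sum_(i < size f) f`_i *: 'X^i) * phi n ^+ 2)) =
   (fun n => \sum_(i < size f) f`_i * L ('X^i * phi n ^+ 2)).
  apply/funext => n; rewrite mulr_suml wint_sum//; apply: eq_bigr => i _.
  by rewrite -scalerAl wintZ.
apply: cvg_big => [|i _]; first exact: add_continuous.
rewrite wintZ// mulrCA; apply: cvgM; first exact: cvg_cst.
rewrite -int_equilibriumE.
exact: cvg_wint_Xn.
Qed.

End JacobiEquidistribution.

(** * The Riccati equation of the seed function *)

Section Riccati.
Variables (R : realType) (a b lam : R).
Implicit Types (x : R).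

(** Dividing T phi = lam phi by phi gives the Riccati equation
p (w' + w^2) + q w = lam for w = phi' / phi = u / B; clearing the denominator
turns it into an identity between polynomials. *)
Lemma log_derivative_Riccati (B u : {poly R}) (phi : R -> R) :
  (forall x, -1 < x < 1 -> derivable phi x 1) ->
  (forall x, -1 < x < 1 -> phi x != 0) ->
  (forall x, -1 < x < 1 -> B.[x] != 0) ->
  (forall x, -1 < x < 1 -> u.[x] = B.[x] * (derive1 phi x / phi x)) ->
  (forall x, -1 < x < 1 -> jacobi_op a b phi x = lam * phi x) ->
  jac_p R * (u^`() * B - u * B^`() + u ^+ 2) + jac_q a b * u * B =
  lam *: B ^+ 2.
Proof.
move=> dphi phi0 B0 hu hphi; apply: poly_eq_oo => x x11.
have d1 y : -1 < y < 1 -> derive1 phi y = u.[y] / B.[y] * phi y.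
  move=> y11; rewrite hu//; field; rewrite phi0// B0//.
have d2 : derive1n 2 phi x =
    ((u^`().[x] * B.[x] - u.[x] * B^`().[x]) / B.[x] ^+ 2 +
     (u.[x] / B.[x]) ^+ 2) * phi x.
  rewrite derive1nS derive1n1 derive1E.
  rewrite (@near_eq_derive R R^o R^o _ (fun y => u.[y] * (B.[y])^-1 * phi y) x 1);
    last exact: near_oo d1.
  have Dphi : is_derive x 1 phi (derive1 phi x).
    by rewrite derive1E; apply: DeriveDef => //; exact: dphi.
  have Du := is_derive_poly u x; have DB := is_derive_poly B x.
  have DV := is_deriveV (B0 _ x11) DB.
  have D := is_deriveM (is_deriveM Du DV) Dphi.
  rewrite [LHS]derive_val /GRing.scale /= d1// -[(horner u * _) x]/(u.[x] * B.[x]^-1).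
  by field; exact: B0.
have := hphi _ x11; rewrite /jacobi_op d2 d1// => E.
have B0x := B0 _ x11; have p0x := phi0 _ x11.
rewrite hornerD 3!hornerM horner_jac_p horner_jac_q.
rewrite !(hornerD, hornerM, hornerN, hornerZ, horner_exp).
apply: (mulIf p0x); apply: (mulIf (invr_neq0 (expf_neq0 2 B0x))).
transitivity (lam * phi x); last by field.
by rewrite -E; field.
Qed.

Lemma derivable_seed_fun k (PN : {poly R}) x : -1 < x < 1 ->
  derivable (seed_fun k a b PN) x 1.
Proof.
move=> /andP[x1 x2].
have D1 := is_derive_1BpowR (- a) x2; have D2 := is_derive_1DpowR (- b) x1.
have D3 := is_derive_poly PN x.
case: k; rewrite /seed_fun.
- exact: (@ex_derive _ _ _ _ _ _ _ (is_deriveM D1 D3)).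
- exact: (@ex_derive _ _ _ _ _ _ _ (is_deriveM D2 D3)).
- exact: (@ex_derive _ _ _ _ _ _ _ (is_deriveM (is_deriveM D1 D2) D3)).
Qed.

Lemma seed_fun_neq0 k (s PN : {poly R}) x : -1 < x < 1 ->
  (s * seed_b0 k PN).[x] != 0 -> seed_fun k a b PN x != 0.
Proof.
move=> /andP[x1 x2] H.
have PN0 : PN.[x] != 0.
  by apply: contraNneq H => P0; case: k; rewrite /seed_b0 !hornerM P0 !mulr0.
have y1 : (1 - x) `^ (- a) != 0 by rewrite lt0r_neq0// powR_gt0//; lra.
have y2 : (1 + x) `^ (- b) != 0 by rewrite lt0r_neq0// powR_gt0//; lra.
by case: k {H}; rewrite /seed_fun !mulf_neq0.
Qed.

End Riccati.

(** * Exceptional weights and the Darboux operator *)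

Section ExceptionalWeight.
Variables (R : realType) (a b : R).
Hypotheses (a1 : -1 < a) (b1 : -1 < b).
Variables (i j : nat) (B bt : {poly R}).
(** i and j are the orders of the zeros of B at 1 and -1. Such a zero lowers the
exponent of the exceptional weight below the one of the Jacobi weight, hence
the sign conditions. *)
Hypothesis hi : (i = 0)%N \/ (i = 1)%N /\ 0 < a.
Hypothesis hj : (j = 0)%N \/ (j = 1)%N /\ 0 < b.
Hypothesis hB : B = (1 - 'X) ^+ i * (1 + 'X) ^+ j * bt.
Hypothesis bt_gt0 : forall x : R, -1 <= x <= 1 -> 0 < bt.[x].
Implicit Types (f g h : {poly R}) (x : R).
Notation W := (xweight a b B).
Notation w := (jacobi_weight a b).
Notation L := (wint w).
Notation LW := (wint W).
Notation p := (jac_p R).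
Notation q := (jac_q a b).
Let aw := admissible_jacobi_weight a1 b1.

Let oocc x : -1 < x < 1 -> -1 <= x <= 1.
Proof. by move=> /andP[x1 x2]; rewrite !ltW. Qed.

Lemma xweight_denE x : B.[x] = (1 - x) ^+ i * (1 + x) ^+ j * bt.[x].
Proof. by rewrite hB !hornerM !horner_exp !hornerE. Qed.

Lemma xweight_den_neq0 x : -1 < x < 1 -> B.[x] != 0.
Proof.
move=> x11; rewrite xweight_denE.
have b0 := bt_gt0 (oocc x11); case/andP: x11 => x1 x2.
by rewrite !mulf_neq0 ?expf_neq0// lt0r_neq0//; lra.
Qed.

Lemma reduced_den_bounded_below : exists2 c : R, 0 < c & forall x, -1 <= x <= 1 -> c <= bt.[x].
Proof.
have le11 : -1 <= 1 :> R by lra.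
have cb : {within `[(-1), 1], continuous (horner bt)}.
  by apply: continuous_subspaceT => x; exact: continuous_horner.
have [c cI Hc] := EVT_min le11 cb.
exists bt.[c]; first by apply: bt_gt0; move: cI; rewrite in_itv.
by move=> x x11; apply: Hc; rewrite in_itv.
Qed.

Lemma xweight_B2 x : -1 < x < 1 -> B.[x] ^+ 2 * W x = (1 - x ^+ 2) * w x.
Proof. by move=> x11; rewrite /xweight; field; exact: xweight_den_neq0. Qed.

Lemma continuous_xweight x : -1 < x < 1 -> {for x, continuous W}.
Proof.
move=> x11; apply: continuousM.
  apply: continuousM; last exact: continuous_jacobi_weight.
  have -> : (fun t : R => 1 - t ^+ 2) = horner p.
    by apply/funext => t; rewrite horner_jac_p.
  exact: continuous_horner_at.
apply: continuousV; first by rewrite expf_neq0// xweight_den_neq0.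
have -> : (fun t : R => B.[t] ^+ 2) = horner (B ^+ 2).
  by apply/funext => t; rewrite horner_exp.
exact: continuous_horner_at.
Qed.

Lemma xweight_ge0 x : -1 < x < 1 -> 0 <= W x.
Proof.
move=> /andP[x1 x2]; rewrite /xweight divr_ge0 ?sqr_ge0// mulr_ge0//; first by nra.
exact: jacobi_weight_ge0.
Qed.

Lemma xweightE x : -1 < x < 1 -> W x =
  jacobi_weight (a + 1 - i%:R *+ 2) (b + 1 - j%:R *+ 2) x / bt.[x] ^+ 2.
Proof.
move=> x11; have B0 := xweight_den_neq0 x11.
apply: (mulfI (expf_neq0 2 B0)); rewrite xweight_B2//.
have bt0 := lt0r_neq0 (bt_gt0 (oocc x11)).
rewrite xweight_denE.
transitivity ((1 - x) ^+ (i * 2) * (1 + x) ^+ (j * 2) *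
  jacobi_weight (a + 1 - i%:R *+ 2) (b + 1 - j%:R *+ 2) x); last first.
  by rewrite !exprM; field.
rewrite -jacobi_weight_shift//.
have -> : a + 1 - i%:R *+ 2 + (i * 2)%:R = a + 1%:R by rewrite natrM; ring.
have -> : b + 1 - j%:R *+ 2 + (j * 2)%:R = b + 1%:R by rewrite natrM; ring.
by rewrite jacobi_weight_shift//; ring.
Qed.

(** Up to the factor bt^-2 the weight W is a Jacobi weight with exponents a + 1 or
a - 1 and b + 1 or b - 1, which exceed -1. *)
Lemma admissible_xweight : admissible_weight W.
Proof.
have [c c0 Hc] := reduced_den_bounded_below.
split; [exact: continuous_xweight|exact: xweight_ge0|].
apply: (@le_oo_integrable _ _ (fun x => c ^- 2 *
   jacobi_weight (a + 1 - i%:R *+ 2) (b + 1 - j%:R *+ 2) x)).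
- exact: continuous_xweight.
- move=> x x11; rewrite ger0_norm ?xweight_ge0// xweightE// mulrC.
  apply: ler_wpM2r; first exact: jacobi_weight_ge0.
  rewrite lef_pV2 ?posrE ?exprn_gt0//; last exact/bt_gt0/oocc.
  by rewrite ler_pXn2r ?nnegrE ?Hc ?oocc// ltW ?bt_gt0 ?oocc.
- apply: oo_integrableZ; apply: integrable_jacobi_weight.
    by move: a1 => ?; case: hi => [->|[-> ?]]; lra.
  by move: b1 => ?; case: hj => [->|[-> ?]]; lra.
Qed.

Lemma wint_xweight_B2 g : LW (B ^+ 2 * g) = L (p * g).
Proof.
apply: eq_int11 => x x11; rewrite !hornerM mulrAC horner_jac_p [B.[x] * _]mulrC.
by rewrite -expr2 xweight_B2//; ring.
Qed.

(** The quotient p bt / B. *)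
Definition p_reduced : {poly R} := (1 - 'X) ^+ (1 - i) * (1 + 'X) ^+ (1 - j).

Lemma horner_p_reduced x :
  p_reduced.[x] = (1 - x) ^+ (1 - i) * (1 + x) ^+ (1 - j).
Proof. by rewrite hornerM !horner_exp !hornerE. Qed.

Lemma p_reduced_eq x : p_reduced.[x] * B.[x] = (1 - x ^+ 2) * bt.[x].
Proof.
rewrite horner_p_reduced xweight_denE.
have i1 : (1 - i + i = 1)%N by case: hi => [->|[-> _]].
have j1 : (1 - j + j = 1)%N by case: hj => [->|[-> _]].
transitivity ((1 - x) ^+ (1 - i + i) * (1 + x) ^+ (1 - j + j) * bt.[x]).
  by rewrite !exprD; ring.
by rewrite i1 j1; ring.
Qed.

Lemma wint_xweight_Bbt g : LW (bt * B * g) = L (p_reduced * g).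
Proof.
apply: eq_int11 => x x11; have B0 := xweight_den_neq0 x11.
apply: (mulfI B0).
transitivity (bt.[x] * g.[x] * (B.[x] ^+ 2 * W x)).
  by rewrite !hornerM; ring.
rewrite xweight_B2// hornerM.
transitivity (p_reduced.[x] * B.[x] * g.[x] * w x); last by ring.
by rewrite p_reduced_eq; ring.
Qed.

Variables (u : {poly R}) (lam : R).
Hypothesis Riccati :
  p * (u^`() * B - u * B^`() + u ^+ 2) + q * u * B = lam *: B ^+ 2.

(** The first-order operator of the Darboux transformation. *)
Definition darboux g : {poly R} := B * g^`() - u * g.

(** The Riccati equation says that the adjoint of the Darboux operator maps the
image of an eigenfunction back to a multiple of that eigenfunction. *)
Lemma darboux_adjoint g mu : jac_op a b g = - mu *: g ->
  B * p * (darboux g)^`() + (p * u + B * q - p * B^`()) * darboux g =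
  - (mu + lam) *: (B ^+ 2 * g).
Proof.
move=> Tg.
transitivity (B ^+ 2 * jac_op a b g
   - (p * (u^`() * B - u * B^`() + u ^+ 2) + q * u * B) * g).
  by rewrite /darboux /jac_op derivB !derivM; ring.
rewrite Riccati Tg -!mul_polyC !(polyCN, polyCD); ring.
Qed.

(** Integration of the derivative of f h (B g' - u g) B W over (-1, 1). The
product B W is a Jacobi weight with positive exponents divided by bt, so there
is no boundary term. *)
Lemma wint_darboux f h g mu : jac_op a b g = - mu *: g ->
  LW (f * darboux h * darboux g) =
  (mu + lam) * L (f * h * g) - LW (f^`() * B * h * darboux g).
Proof.
move=> Tg.
have aW := admissible_xweight.
set X := darboux g.
have [S SE] : exists S, S = f * h * X by exists (f * h * X).
have [G GE] : exists G, G = f * darboux h * X + f^`() * B * h * X by eexists.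
have [H HE] : exists H, H = f * h * g by eexists.
have Sid : B * (S^`() * p + S * q) - S * p * B^`() = p * G - (mu + lam) *: (B ^+ 2 * H).
  transitivity (p * G + f * h * (B * p * X^`() + (p * u + B * q - p * B^`()) * X)).
    by rewrite GE SE /darboux derivM derivM; ring.
  rewrite (darboux_adjoint Tg) -!mul_polyC polyCN HE; ring.
pose F x := S.[x] * (B.[x])^-1 * jacobi_weight (a + 1) (b + 1) x.
pose ff x := G.[x] * W x + ((- (mu + lam)) *: H).[x] * w x.
have iff : oo_integrable ff by apply: oo_integrableD; exact: wintable.
have ff0 : int11 ff = 0.
  have [c c0 Hc] := reduced_den_bounded_below.
  have [C C0 HC] := horner_bounded S.
  have [|||F1 F2] := @cvg0_bounded_jacobi_weight R (a + 1 - i%:R) (b + 1 - j%:R)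
     (fun x => S.[x] / bt.[x]) (C / c).
  - by move: (a1) => ?; case: hi => [->|[-> ?]]; lra.
  - by move: (b1) => ?; case: hj => [->|[-> ?]]; lra.
  - move=> x /oocc x11; rewrite normrM normfV (gtr0_norm (bt_gt0 x11)).
    apply: ler_pM; rewrite ?normr_ge0 ?invr_ge0 ?HC//; first by rewrite ltW ?bt_gt0.
    by rewrite lef_pV2 ?posrE ?bt_gt0 ?Hc.
  have FE x : -1 < x < 1 ->
      S.[x] / bt.[x] * jacobi_weight (a + 1 - i%:R) (b + 1 - j%:R) x = F x.
    move=> x11; rewrite /F xweight_denE.
    have -> : jacobi_weight (a + 1) (b + 1) x =
        jacobi_weight (a + 1 - i%:R + i%:R) (b + 1 - j%:R + j%:R) x.
      by rewrite !subrK.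
    rewrite jacobi_weight_shift//.
    have bt0 := lt0r_neq0 (bt_gt0 (oocc x11)).
    case/andP: x11 => x1 x2.
    have y1 : (1 - x) ^+ i != 0 by rewrite expf_neq0// lt0r_neq0//; lra.
    have y2 : (1 + x) ^+ j != 0 by rewrite expf_neq0// lt0r_neq0//; lra.
    by field; rewrite y1 y2 bt0.
  rewrite -[RHS](subrr 0).
  apply: (@FTC_oo _ _ _ F) => //.
  - move=> x x11.
    have B0 := xweight_den_neq0 x11.
    have DJ := is_derive_jacobi_weight a b x11.
    have D := is_deriveM (is_deriveM (is_derive_poly S x)
       (is_deriveV B0 (is_derive_poly B x))) DJ.
    apply: is_derive_eq.
    rewrite /GRing.scale /= -[(horner S * _) x]/(S.[x] * B.[x]^-1).
    rewrite -[a + 1]/(a + 1%:R) -[b + 1]/(b + 1%:R) jacobi_weight_shift//.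
    apply: (mulfI (expf_neq0 2 B0)).
    rewrite /ff [RHS]mulrDr [X in _ = X + _]mulrCA xweight_B2// hornerZ.
    have := congr1 (horner^~ x) Sid => /=.
    rewrite !hornerD !hornerN hornerZ [(B ^+ 2 * H).[x]]hornerM horner_exp.
    rewrite [(B * _).[x]]hornerM hornerD !hornerM horner_jac_p horner_jac_q.
    move=> /(congr1 ( *%R^~ (w x))) Sx.
    rewrite [RHS](_ : _ = ((1 - x ^+ 2) * G.[x] - (mu + lam) * (B.[x] ^+ 2 * H.[x])) * w x);
      last by ring.
    by rewrite -Sx; field.
  - move=> x x11; apply: continuousD; apply: continuousM.
    + exact: continuous_horner_at.
    + exact: continuous_xweight.
    + exact: continuous_horner_at.
    + exact: continuous_jacobi_weight.
  - apply: cvg_trans F2; apply: near_eq_cvg; near=> x; apply: FE.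
    by apply/andP; split; near: x; [exact: nbhs_right_gt|apply: nbhs_right_lt; lra].
  - apply: cvg_trans F1; apply: near_eq_cvg; near=> x; apply: FE.
    by apply/andP; split; near: x; [apply: nbhs_left_gt; lra|exact: nbhs_left_lt].
move: ff0; rewrite /ff int11D; try exact: wintable.
rewrite -/(wint W G) -/(wint w (_ *: H)) wintZ// GE wintD// HE => E.
by apply/eqP; rewrite -subr_eq0 -[X in _ == X]E; apply/eqP; ring.
Unshelve. all: by end_near. Qed.

Variable phi : nat -> {poly R}.
Hypothesis Tphi : forall n, jac_op a b (phi n) = - jac_eig a b n *: phi n.
Hypothesis phi1 : forall n, L (phi n ^+ 2) = 1.
Hypothesis size_phi : forall n, (size (phi n) <= n.+1)%N.
Hypothesis norm_gt0 : forall n, 0 < LW (darboux (phi n) ^+ 2).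
Notation Xi n := (darboux (phi n)).

Let aW := admissible_xweight.

Lemma wint_normalize_sqr n f :
  LW (f * normalize W (Xi n) ^+ 2) = (LW (Xi n ^+ 2))^-1 * LW (f * Xi n ^+ 2).
Proof.
have N2 : wnorm W (horner (Xi n)) ^+ 2 = LW (Xi n ^+ 2).
  rewrite /wnorm sqr_sqrtr.
    by apply: eq_int11 => x _; rewrite horner_exp.
  by apply: int11_ge0 => x /xweight_ge0 W0; rewrite mulr_ge0 ?sqr_ge0.
by rewrite /normalize exprZn -scalerAr wintZ// exprVn N2.
Qed.

Lemma wint_normalize1 n : LW (normalize W (Xi n) ^+ 2) = 1.
Proof.
by rewrite -[X in LW X]mul1r wint_normalize_sqr mul1r mulVf// gt_eqF.
Qed.

(** The case f = 1 of [wint_darboux]. *)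
Lemma darboux_norm n : LW (Xi n ^+ 2) = jac_eig a b n + lam.
Proof.
have := wint_darboux 1 (phi n) (Tphi n); rewrite !mul1r -expr2 => ->.
by rewrite -(expr2 (phi n)) phi1 mulr1 derivC !mul0r wint0// subr0.
Qed.

(** The measures Xhat_n^2 W and phi_n^2 w have the same limit: their
difference is a cross term of order n^-1 by Cauchy-Schwarz. *)
Lemma exceptional_equidistribution f :
  LW (f * normalize W (Xi n) ^+ 2) @[n --> \oo] --> int_equilibrium (horner f).
Proof.
have [C C0 HC] := horner_bounded f^`().
pose d n := LW (f^`() * (B * phi n) * Xi n) / LW (Xi n ^+ 2).
have dE n : LW (f * normalize W (Xi n) ^+ 2) = L (f * phi n ^+ 2) - d n.
  rewrite wint_normalize_sqr.
  have -> : f * Xi n ^+ 2 = f * Xi n * Xi n by rewrite -mulrA -expr2.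
  rewrite (wint_darboux f (phi n) (Tphi n)) -darboux_norm /d.
  have -> : f * phi n * phi n = f * phi n ^+ 2 by rewrite -mulrA -expr2.
  rewrite mulrA; field; exact: lt0r_neq0.
have d0 : d n @[n --> \oo] --> (0 : R).
  apply: (@cvg0_of_eig _ _ _ a1 b1 d C lam) => n.
  rewrite -darboux_norm /d.
  set N := LW (Xi n ^+ 2); have N0 : 0 < N by exact: norm_gt0.
  set c := LW _.
  have -> : N * (c / N) ^+ 2 = c ^+ 2 / N by field; exact: lt0r_neq0.
  rewrite ler_pdivrMr//.
  have fC x : -1 < x < 1 -> `|f^`().[x]| <= C by move=> /oocc; exact: HC.
  apply: (le_trans (wint_CauchySchwarz aW (B * phi n) (Xi n) C0 fC)).
  rewrite -/N ler_wpM2r ?(ltW N0)// exprMn wint_xweight_B2.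
  by rewrite ler_piMr ?sqr_ge0// (wint_p_sqr_le1 a1 b1).
rewrite (_ : (fun n => _) = (fun n => L (f * phi n ^+ 2) - d n)); last exact/funext.
rewrite -[int_equilibrium _]subr0.
by apply: cvgB => //; exact: jacobi_equidistribution.
Qed.

(** Multiplication by a primitive Q of bt is banded in the basis X: in the
integration by parts, [Q' b W = bt b W] is a polynomial multiple of the Jacobi
weight. *)
Lemma darboux_band (Q : {poly R}) : Q^`() = bt ->
  exists D : nat, forall n k, (k + D < n)%N -> LW (Q * Xi n * Xi k) = 0.
Proof.
move=> QB; exists (size Q + (size p_reduced + (size B + size u)) + 2)%N => n k kDn.
rewrite (wint_darboux Q (phi n) (Tphi k)) QB.
have -> : bt * B * phi n * Xi k = bt * B * (phi n * Xi k) by rewrite !mulrA.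
rewrite wint_xweight_Bbt.
have -> : p_reduced * (phi n * Xi k) = phi n * (p_reduced * Xi k) by ring.
have -> : Q * phi n * phi k = phi n * (Q * phi k) by ring.
have sk := size_phi k.
have sM (g h : {poly R}) : (size (g * h)%R <= size g + size h)%N.
  by rewrite (leq_trans (size_polyMleq _ _))// leq_pred.
rewrite (jac_eigen_orth a1 b1 (Tphi n)); last by move: (sM Q (phi k)); lia.
rewrite (jac_eigen_orth a1 b1 (Tphi n)) ?mulr0 ?subr0//.
have sk' : (size (phi k)^`() <= k.+1)%N.
  have [->|p0] := eqVneq (phi k) 0; first by rewrite deriv0 size_poly0.
  exact: ltnW (leq_trans (lt_size_deriv p0) sk).
have sX : (size (Xi k) <= size B + size u + k.+1)%N.
  rewrite (leq_trans (size_polyD _ _))// geq_max size_polyN; apply/andP; split.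
    by apply: leq_trans (sM _ _) _; lia.
  by apply: leq_trans (sM _ _) _; lia.
by apply: leq_trans (sM _ _) _; lia.
Qed.

Lemma normalize_band (Q : {poly R}) : Q^`() = bt -> exists D, forall n k,
  (k + D < n)%N -> LW (Q * normalize W (Xi n) * normalize W (Xi k)) = 0.
Proof.
move=> /darboux_band[D HD]; exists D => n k kDn.
rewrite /normalize; set c := _^-1; set d := _^-1.
have -> : Q * (c *: Xi n) * (d *: Xi k) = (c * d) *: (Q * Xi n * Xi k).
  by rewrite -!mul_polyC polyCM; ring.
by rewrite wintZ// HD// mulr0.
Qed.

End ExceptionalWeight.

(** * Truncations of banded multiplication matrices *)

Section BandedTruncation.
Variables (R : realType) (w : R -> R).
Hypothesis aw : admissible_weight w.
Notation L := (wint w).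
Variable e : nat -> {poly R}.
Hypothesis orthonormal : forall i k, L (e i * e k) = (i == k)%:R.
Hypothesis complete : forall f, (forall k, L (f * e k) = 0) -> L (f ^+ 2) = 0.
Variables (Q : {poly R}) (D : nat).
Hypothesis band : forall n k, (k + D < n)%N -> L (Q * e n * e k) = 0.

Lemma band_sym i k : L (Q * e i * e k) = L (Q * e k * e i).
Proof. by congr wint; ring. Qed.

(** A polynomial orthogonal to every e k has zero norm, so Q e k is its finite
expansion, as far as integrals can see. *)
Lemma band_expand n k h : (k + D < n)%N ->
  L (Q * e k * h) = \sum_(i < n) L (Q * e k * e i) * L (e i * h).
Proof.
move=> kDn; pose c i := L (Q * e k * e i).
pose g := Q * e k - \sum_(i < n) c i *: e i.
have gE h' : L (g * h') = L (Q * e k * h') - \sum_(i < n) c i * L (e i * h').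
  rewrite /g mulrBl wintB// mulr_suml wint_sum//; congr (_ - _).
  by apply: eq_bigr => i _; rewrite -scalerAl wintZ.
have g0 : L (g ^+ 2) = 0.
  apply: complete => j; rewrite gE; have [jn|nj] := ltnP j n.
    rewrite (bigD1 (Ordinal jn))//= orthonormal eqxx mulr1 big1 ?addr0 ?subrr// => i ij.
    by rewrite orthonormal (_ : (i == j :> nat) = false) ?mulr0//; apply/negbTE.
  rewrite band_sym band ?(leq_trans kDn)// big1 ?subr0// => i _.
  by rewrite orthonormal (_ : (i == j :> nat) = false) ?mulr0// ltn_eqF// (leq_trans _ nj).
by have /eqP := wint_null aw h g0; rewrite gE subr_eq0 => /eqP.
Qed.

Definition truncation n : 'M[R]_n := \matrix_(i, k) L (Q * e i * e k).

(** A path of l steps of length at most D from an index k with k + l D < n never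
meets the truncation. *)
Lemma truncation_pow l n (k j : 'I_n) : (k + l * D < n)%N ->
  (truncation n ^+ l) k j = L (Q ^+ l * e k * e j).
Proof.
elim: l k => [|l IHl] k kn.
  by rewrite !expr0 mxE mul1r orthonormal.
rewrite exprS mxE.
transitivity (\sum_(i < n) L (Q * e k * e i) * L (e i * (Q ^+ l * e j))).
  apply: eq_bigr => i _; rewrite mxE; have [ikD|kDi] := leqP i (k + D).
    rewrite IHl; last by rewrite (leq_ltn_trans _ kn)// mulSn addnA leq_add2r.
    by congr (_ * wint _ _); ring.
  by rewrite band_sym band// !mul0r.
rewrite -band_expand; last by rewrite (leq_ltn_trans _ kn)// leq_add2l mulSn leq_addr.
by congr wint; rewrite exprS; ring.
Qed.

Lemma entry_bound f (C : R) : 0 <= C ->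
  (forall x : R, -1 < x < 1 -> `|f.[x]| <= C) ->
  forall i k, `|L (f * e i * e k)| <= C.
Proof.
move=> C0 fC i k.
have := wint_CauchySchwarz aw (e i) (e k) C0 fC.
rewrite !expr2 !orthonormal !eqxx !mulr1 -!expr2 => H.
by rewrite -(ler_pXn2r (n := 2)) ?nnegrE// real_normK ?num_real.
Qed.

Lemma card_window n x c : (#|[pred j : 'I_n | x <= j < x + c]| <= c)%N.
Proof.
case: c => [|c].
  rewrite eq_card0// => j; rewrite !inE addn0.
  by apply/negP => /andP[H1 /(leq_ltn_trans H1)]; rewrite ltnn.
rewrite -[X in (_ <= X)%N](card_ord c.+1).
apply: (@leq_card_in _ _ (fun j : 'I_n => inord (j - x) : 'I_c.+1)).
move=> i j; rewrite !inE => /andP[i1 i2] /andP[j1 j2] /(congr1 val) /=.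
rewrite !inordK ?ltn_subLR// => H; apply: val_inj => /=.
by rewrite -(subnKC i1) H subnKC.
Qed.

Lemma sum_window (F : nat -> R) n x c (C : R) : 0 <= C ->
  (forall j, (j < n)%N -> F j <= C) ->
  (forall j, (j < n)%N -> ~~ (x <= j < x + c)%N -> F j <= 0) ->
  \sum_(j < n) F j <= c%:R * C.
Proof.
move=> C0 FC F0.
apply: (@le_trans _ _ (\sum_(j < n | (x <= j < x + c)%N) C)).
  rewrite [leRHS]big_mkcond; apply: ler_sum => j _.
  by case: ifPn => H; [exact: FC|exact: F0].
rewrite sumr_const -[leLHS]mulr_natl ler_wpM2r// ler_nat.
exact: card_window.
Qed.

(** At most 2 D + 1 entries of each row are nonzero, hence bounds on the powers
that do not depend on the size n. *)
Lemma truncation_row_sum : exists2 S : R, 0 <= S &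
  forall l n (k : 'I_n), \sum_(j < n) `|(truncation n ^+ l) k j| <= S ^+ l.
Proof.
have [C C0 HC] := horner_bounded Q.
have QC x : -1 < x < 1 -> `|Q.[x]| <= C.
  by move=> /andP[x1 x2]; apply: HC; rewrite !ltW.
pose S := (D + D).+1%:R * C; have S0 : 0 <= S by rewrite mulr_ge0.
exists S => // l n; elim: l => [|l IHl] k.
  rewrite expr0 (bigD1 k)//= mxE eqxx normr1 big1 ?addr0// => j jk.
  by rewrite mxE eq_sym (negbTE jk) normr0.
rewrite exprS.
apply: (@le_trans _ _ (\sum_(j < n) \sum_(i < n)
    `|truncation n k i| * `|(truncation n ^+ l) i j|)).
  apply: ler_sum => j _; rewrite mxE; apply: le_trans (ler_norm_sum _ _ _) _.
  by apply: ler_sum => i _; rewrite normrM.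
rewrite exchange_big /=.
apply: (@le_trans _ _ (\sum_(i < n) `|truncation n k i| * S ^+ l)).
  by apply: ler_sum => i _; rewrite -mulr_sumr ler_wpM2l.
rewrite -mulr_suml exprS; apply: ler_wpM2r; first exact: exprn_ge0.
under eq_bigr do rewrite mxE.
apply: (@sum_window (fun i => `|L (Q * e k * e i)|) n (k - D)) => //.
  by move=> i _; exact: entry_bound.
move=> i _ H; have [ikD|kDi] := ltnP (k + D) i.
  by rewrite band_sym band ?normr0.
have Dik : (i + D < k)%N by move: H kDi; clear; lia.
by rewrite band ?normr0.
Qed.

(** All but the last l D diagonal entries of the power of the truncation are
those of the power of the infinite banded matrix, so that their mean is a
Cesaro mean up to O(1/n). *)
Lemma cvg_mean_trace l (E : R) :
  L (Q ^+ l * e k ^+ 2) @[k --> \oo] --> E ->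
  n%:R^-1 * \tr (truncation n ^+ l) @[n --> \oo] --> E.
Proof.
pose a k := L (Q ^+ l * e k ^+ 2); move=> aE.
have aE' k : a k = L (Q ^+ l * e k * e k) by rewrite /a expr2 mulrA.
have [C C0 HC] := horner_bounded (Q ^+ l).
have QC x : -1 < x < 1 -> `|(Q ^+ l).[x]| <= C.
  by move=> /andP[x1 x2]; apply: HC; rewrite !ltW.
have [S S0 HS] := truncation_row_sum.
pose K := (l * D)%:R * (S ^+ l + C).
have diff n : `|\tr (truncation n ^+ l) - series a n| <= K.
  rewrite /series /= big_mkord /mxtrace -sumrB.
  apply: le_trans (ler_norm_sum _ _ _) _.
  have SC : 0 <= S ^+ l + C by rewrite addr_ge0 ?exprn_ge0.
  pose F k := oapp (fun k' : 'I_n => `|(truncation n ^+ l) k' k' - a k'|) 0 (insub k).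
  rewrite (eq_bigr (fun k : 'I_n => F k)); last by move=> k _; rewrite /F valK.
  apply: (@sum_window F n (n - l * D)%N) => //.
    move=> k kn; rewrite /F insubT /= aE'.
    apply: le_trans (ler_normB _ _) _; apply: lerD; last exact: entry_bound.
    apply: le_trans (HS l n (Sub k kn)).
    rewrite (bigD1 (Sub k kn))//= lerDl; exact: sumr_ge0.
  move=> k kn H; rewrite /F insubT /= truncation_pow ?aE' ?subrr ?normr0//=.
  by move: H kn; clear; lia.
have mE : n%:R^-1 * series a n @[n --> \oo] --> E.
  by rewrite -cvg_shiftS; exact: cesaro.
have dE : n%:R^-1 * (\tr (truncation n ^+ l) - series a n) @[n --> \oo] --> (0 : R).
  apply/cvgrPdist_lt => eps eps0; near=> n.
  have n0 : 0 < n%:R :> R by rewrite ltr0n; near: n; exact: nbhs_infty_gt.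
  have nK : K / eps < n%:R by near: n; exact: nbhs_infty_gtr.
  rewrite sub0r normrN normrM normfV (gtr0_norm n0) mulrC ltr_pdivrMr//.
  by rewrite (le_lt_trans (diff n))// mulrC -ltr_pdivrMr.
rewrite -[E]add0r.
rewrite (_ : (fun n => _) = (fun n => n%:R^-1 * (\tr (truncation n ^+ l) - series a n)
   + n%:R^-1 * series a n)); first exact: cvgD.
by apply/funext => n; ring.
Unshelve. all: by end_near. Qed.

End BandedTruncation.

(** * Power sums of eigenvalues *)

Section PowerSums.
Variable C : numClosedFieldType.

Lemma trig_mx_pow n (T : 'M[C]_n) l : is_trig_mx T ->
  is_trig_mx (T ^+ l) /\ forall i, (T ^+ l) i i = T i i ^+ l.
Proof.
move=> Tt; elim: l => [|l [/is_trig_mxP IHt IHd]].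
  split; first by rewrite expr0; apply/is_trig_mxP => i j ij; rewrite mxE -val_eqE ltn_eqF.
  by move=> i; rewrite !expr0 mxE eqxx.
move/is_trig_mxP: Tt => Tt; split.
  apply/is_trig_mxP => i j ij; rewrite exprS mxE big1// => k _.
  have [ik|ki] := ltnP i k; first by rewrite Tt ?mul0r.
  by rewrite IHt ?mulr0// (leq_ltn_trans ki ij).
move=> i; rewrite exprS mxE (bigD1 i)//= IHd -exprS big1 ?addr0// => k ki.
have [ik|ik] := ltnP i k; first by rewrite Tt ?mul0r.
by rewrite IHt ?mulr0// ltn_neqAle ik andbT val_eqE.
Qed.

Lemma char_poly_similar n (P A : 'M[C]_n) : P \in unitmx ->
  char_poly (invmx P *m A *m P) = char_poly A.
Proof.
move=> Pu; rewrite /char_poly /char_poly_mx.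
have PP : map_mx polyC (invmx P) *m map_mx polyC P = 1%:M.
  by rewrite -map_mxM mulVmx// map_mx1.
have -> : 'X%:M - map_mx polyC (invmx P *m A *m P) =
    map_mx polyC (invmx P) *m ('X%:M - map_mx polyC A) *m map_mx polyC P.
  rewrite mulmxBr mulmxBl !map_mxM; congr (_ - _).
  by rewrite scalar_mxC -mulmxA PP mulmx1.
rewrite !det_mulmx mulrAC -det_mulmx PP det1 mul1r//.
Qed.

(** By triangularization: the power of a triangular matrix has the powers of its
diagonal entries on the diagonal. *)
Lemma mxtrace_pow_roots n (A : 'M[C]_n) (z : 'I_n -> C) l :
  char_poly A = \prod_(i < n) ('X - (z i)%:P) ->
  \tr (A ^+ l) = \sum_(i < n) z i ^+ l.
Proof.
case: n => [|n] in A z *; first by rewrite /mxtrace !big_ord0.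
move=> cA; have [P /unitarymx_unit Pu] := Schur A isT.
pose T := conjmx P A => Tt0.
have Tt : is_trig_mx T := Tt0.
have AE : A = invmx P *m T *m P by rewrite -conjVmx// conjmxK.
clearbody T; clear Tt0.
have powA k : A ^+ k = invmx P *m T ^+ k *m P.
  elim: k => [|k IHk]; first by rewrite !expr0 mulmx1 mulVmx.
  rewrite exprS IHk {1}AE -[_ * _]/(_ *m _) exprS -[T * _]/(T *m _).
  by rewrite -!mulmxA (mulmxA P) mulmxV// mul1mx.
have [_ Td] := trig_mx_pow l Tt.
rewrite powA mxtrace_mulC mulmxA mulmxV// mul1mx /mxtrace.
rewrite (eq_bigr (fun i => T i i ^+ l)) => [|i _]; last exact: Td.
have E : \prod_(x <- [seq T i i | i <- index_enum 'I_n.+1]) ('X - x%:P) =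
         \prod_(x <- [seq z i | i <- index_enum 'I_n.+1]) ('X - x%:P).
  rewrite !big_map -cA AE char_poly_similar// char_poly_trig//.
have := perm_big _ (prod_XsubC_eq E) (x := 0) (op := +%R) (P := predT)
  (F := fun x => x ^+ l).
by rewrite !big_map.
Qed.

End PowerSums.

(** * The average characteristic polynomial *)

Section IteratedIntegral.
Variable R : realType.

Lemma oo_integrable_sum (J : Type) (r : seq J) (c : J -> R) (g : J -> R -> R) :
  (forall j, oo_integrable (g j)) ->
  oo_integrable (fun x => \sum_(j <- r) c j * g j x).
Proof.
move=> gi; elim: r => [|j r IHr].
  apply: (@eq_oo_integrable _ (fun x => 0)) => [x _|]; first by rewrite big_nil.
  exact: integrable0.
apply: (@eq_oo_integrable _ (fun x => c j * g j x + \sum_(j <- r) c j * g j x)).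
  by move=> x _; rewrite big_cons.
by apply: oo_integrableD => //; exact: oo_integrableZ.
Qed.

Lemma int11_sum (J : Type) (r : seq J) (c : J -> R) (g : J -> R -> R) :
  (forall j, oo_integrable (g j)) ->
  int11 (fun x => \sum_(j <- r) c j * g j x) = \sum_(j <- r) c j * int11 (g j).
Proof.
move=> gi; elim: r => [|j r IHr].
  rewrite big_nil -[RHS](@mul0r _ (int11 (fun=> 0))) -int11Z; last exact: integrable0.
  by apply: eq_int11 => x _; rewrite big_nil mul0r.
rewrite big_cons -IHr -int11Z// -int11D; [|exact: oo_integrableZ|exact: oo_integrable_sum].
by apply: eq_int11 => x _; rewrite big_cons.
Qed.

Lemma int11n_sum_prod n (J : finType) (c : J -> R) (g : J -> 'I_n -> R -> R) :
  (forall j i, oo_integrable (g j i)) ->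
  int11n (fun t : n.-tuple R => \sum_j c j * \prod_i g j i (tnth t i)) =
  \sum_j c j * \prod_i int11 (g j i).
Proof.
elim: n c g => [|n IHn] c g gi /=.
  by apply: eq_bigr => j _; rewrite !big_ord0.
transitivity (int11 (fun x => \sum_j (c j * \prod_(i < n) int11 (g j (lift ord0 i))) *
    g j ord0 x)); last first.
  by rewrite int11_sum//; apply: eq_bigr => j _; rewrite big_ord_recl; ring.
apply: eq_int11 => x _.
transitivity (\sum_j (c j * g j ord0 x) * \prod_(i < n) int11 (g j (lift ord0 i)));
  last by apply: eq_bigr => j _; ring.
rewrite -IHn//; congr int11n; apply/funext => t; apply: eq_bigr => j _.
rewrite big_ord_recl tnth0 mulrA; congr (_ * _).
by apply: eq_bigr => i _; rewrite tnthS.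
Qed.

End IteratedIntegral.

(** Expressing the second permutation relative to the first turns each inner sum
into the determinant. *)
Lemma sum_perm_pair (F : comNzRingType) n (N : 'M[F]_n) :
  \sum_(st : 'S_n * 'S_n) (-1) ^+ st.1 * (-1) ^+ st.2 *
     \prod_i N (st.1 i) (st.2 i) = n`!%:R * \det N.
Proof.
rewrite -(pair_bigA _ (fun s t : 'S_n => (-1) ^+ s * (-1) ^+ t * \prod_i N (s i) (t i))).
transitivity (\sum_(s : 'S_n) \det N); last first.
  by rewrite sumr_const -[LHS]mulr_natl card_Sn.
apply: eq_bigr => s _ /=.
rewrite (reindex_inj (mulgI s)) /=; apply: eq_bigr => t _.
rewrite odd_permM signr_addb mulrA -signr_addb addbb mul1r; congr (_ * _).
rewrite [RHS](reindex_inj (@perm_inj _ s)) /=.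
by apply: eq_bigr => i _; rewrite permM.
Qed.

Section DeterminantalProcess.
Variables (R : realType) (W : R -> R).
Hypothesis aW : admissible_weight W.
Variable X : nat -> {poly R}.
Notation e := (fun k => normalize W (X k)).
Hypothesis orthonormal : forall i k, wint W (e i * e k) = (i == k)%:R.
Notation L := (wint W).
Local Notation C := R[i].

(** The kernel matrix is A A^T with A i k = e k (t i), so its determinant is
(det A)^2. *)
Lemma dpp_weightE n (t : n.-tuple R) : dpp_weight W X t =
  \sum_(st : 'S_n * 'S_n) (-1) ^+ st.1 * (-1) ^+ st.2 *
    \prod_i ((e (st.1 i) * e (st.2 i)).[tnth t i] * W (tnth t i)).
Proof.
rewrite /dpp_weight.
pose A : 'M[R]_n := \matrix_(i, k) (e k).[tnth t i].
have -> : (\matrix_(i < n, j < n) kernel_K W X n (tnth t i) (tnth t j)) = A *m A^T.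
  by apply/matrixP => i j; rewrite !mxE; apply: eq_bigr => k _; rewrite !mxE.
rewrite det_mulmx det_tr /determinant -(pair_bigA _ (fun s u : 'S_n =>
   (-1) ^+ s * (-1) ^+ u * \prod_i ((e (s i) * e (u i)).[tnth t i] * W (tnth t i)))).
rewrite !mulr_suml; apply: eq_bigr => s _ /=.
rewrite mulr_sumr mulr_suml; apply: eq_bigr => u _ /=.
rewrite mulrACA -!mulrA; congr (_ * (_ * _)); rewrite mulrA -!big_split /=.
by apply: eq_bigr => i _; rewrite !mxE hornerM.
Qed.

Definition andreief n (h : 'I_n -> {poly R}) : R :=
  \sum_(st : 'S_n * 'S_n) (-1) ^+ st.1 * (-1) ^+ st.2 *
     \prod_i L (h i * e (st.1 i) * e (st.2 i)).

(** Andreief's identity, for sums of products of functions of one variable. *)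
Lemma int11n_dpp_weight n (J : finType) (c : J -> R) (h : J -> 'I_n -> {poly R}) :
  int11n (fun t : n.-tuple R =>
     (\sum_j c j * \prod_i (h j i).[tnth t i]) * dpp_weight W X t) =
  \sum_j c j * andreief (h j).
Proof.
transitivity (int11n (fun t : n.-tuple R => \sum_(js : J * ('S_n * 'S_n))
   (c js.1 * ((-1) ^+ js.2.1 * (-1) ^+ js.2.2)) *
   \prod_i ((h js.1 i * e (js.2.1 i) * e (js.2.2 i)).[tnth t i] * W (tnth t i)))).
  congr int11n; apply/funext => t; rewrite dpp_weightE.
  rewrite -(pair_bigA _ (fun j (st : 'S_n * 'S_n) =>
   (c j * ((-1) ^+ st.1 * (-1) ^+ st.2)) *
   \prod_i ((h j i * e (st.1 i) * e (st.2 i)).[tnth t i] * W (tnth t i)))) /=.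
  rewrite mulr_suml; apply: eq_bigr => j _; rewrite mulr_sumr; apply: eq_bigr => st _.
  rewrite mulrACA -!mulrA; congr (_ * (_ * (_ * _))); rewrite -big_split /=.
  by apply: eq_bigr => i _; rewrite !hornerM; ring.
rewrite (@int11n_sum_prod _ _ _
  (fun js : J * ('S_n * 'S_n) => c js.1 * ((-1) ^+ js.2.1 * (-1) ^+ js.2.2))
  (fun js i x => (h js.1 i * e (js.2.1 i) * e (js.2.2 i)).[x] * W x)); last first.
  by move=> j i; exact: wintable.
rewrite -(pair_bigA _ (fun j (st : 'S_n * 'S_n) =>
   (c j * ((-1) ^+ st.1 * (-1) ^+ st.2)) *
   \prod_i L (h j i * e (st.1 i) * e (st.2 i)))) /=.
apply: eq_bigr => j _; rewrite mulr_sumr; apply: eq_bigr => st _.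
by rewrite !mulrA.
Qed.

Lemma dpp_weight_total n : int11n (@dpp_weight R W X n) = n`!%:R.
Proof.
transitivity (int11n (fun t : n.-tuple R =>
    (\sum_(j : unit) 1 * \prod_(i < n) (1 : {poly R}).[tnth t i]) * dpp_weight W X t)).
  congr int11n; apply/funext => t.
  rewrite big_const card_unit /= addr0 mul1r big1 ?mul1r// => i _.
  by rewrite hornerC.
rewrite (@int11n_dpp_weight n unit (fun=> 1) (fun _ _ => 1)).
rewrite big_const card_unit /= addr0 mul1r /andreief.
transitivity (n`!%:R * \det (1%:M : 'M[R]_n)); last by rewrite det1 mulr1.
rewrite -sum_perm_pair; apply: eq_bigr => st _; congr (_ * _).
by apply: eq_bigr => i _; rewrite mul1r orthonormal mxE.
Qed.

Lemma ReD (x y : C) : complex.Re (x + y) = complex.Re x + complex.Re y.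
Proof. by case: x y => [? ?] [? ?]. Qed.
Lemma ImD (x y : C) : complex.Im (x + y) = complex.Im x + complex.Im y.
Proof. by case: x y => [? ?] [? ?]. Qed.
Lemma ReMr (x : C) (r : R) : complex.Re (x * r%:C) = complex.Re x * r.
Proof. by case: x => [a b] /=; rewrite mulr0 subr0. Qed.
Lemma ImMr (x : C) (r : R) : complex.Im (x * r%:C) = complex.Im x * r.
Proof. by case: x => [a b] /=; rewrite mulr0 add0r. Qed.

Lemma cexpect_sum_prod n (J : finType) (c : J -> C) (h : J -> 'I_n -> {poly R}) :
  cexpect W X (fun t : n.-tuple R => \sum_j c j * (\prod_i (h j i).[tnth t i])%:C) =
  \sum_j c j * (n`!%:R^-1 * andreief (h j))%:C.
Proof.
have E (a : J -> R) :
   expect W X (fun t : n.-tuple R => \sum_j a j * \prod_i (h j i).[tnth t i]) =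
   \sum_j a j * (n`!%:R^-1 * andreief (h j)).
  rewrite /expect /dpp_density dpp_weight_total.
  transitivity (int11n (fun t : n.-tuple R =>
     (\sum_j (a j * n`!%:R^-1) * \prod_i (h j i).[tnth t i]) * dpp_weight W X t)).
    congr int11n; apply/funext => t; rewrite mulrA; congr (_ * _).
    by rewrite mulr_suml; apply: eq_bigr => j _; rewrite mulrAC.
  by rewrite int11n_dpp_weight; apply: eq_bigr => j _; rewrite mulrA.
rewrite /cexpect.
have -> : (fun t : n.-tuple R => complex.Re (\sum_j c j * (\prod_i (h j i).[tnth t i])%:C)) =
  (fun t => \sum_j complex.Re (c j) * \prod_i (h j i).[tnth t i]).
  apply/funext => t; rewrite (big_morph _ ReD (erefl (complex.Re (0 : C)))) /=.
  by apply: eq_bigr => j _; rewrite ReMr.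
have -> : (fun t : n.-tuple R => complex.Im (\sum_j c j * (\prod_i (h j i).[tnth t i])%:C)) =
  (fun t => \sum_j complex.Im (c j) * \prod_i (h j i).[tnth t i]).
  apply/funext => t; rewrite (big_morph _ ImD (erefl (complex.Im (0 : C)))) /=.
  by apply: eq_bigr => j _; rewrite ImMr.
rewrite !E; apply/eqP; rewrite eq_complex /=.
rewrite (big_morph _ ReD (erefl (complex.Re (0 : C)))).
rewrite (big_morph _ ImD (erefl (complex.Im (0 : C)))) /=.
apply/andP; split; apply/eqP; apply: eq_bigr => j _.
  by rewrite ReMr.
by rewrite ImMr.
Qed.

(** Splitting each factor z - Q(x_i) into its two terms writes the observable as
a sum of products of real functions of one variable with complex coefficients;
the resulting signed sums over pairs of permutations recombine into
n! det (z - M). *)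
Theorem mod_avg_charpoly_char_poly (Q : {poly R}) n (z : C) :
  mod_avg_charpoly W X Q n z =
  (char_poly (map_mx (real_complex R) (truncation W e Q n))).[z].
Proof.
rewrite /mod_avg_charpoly.
pose c (S : {ffun 'I_n -> bool}) : C := \prod_i (if S i then z else 1).
pose h (S : {ffun 'I_n -> bool}) (i : 'I_n) : {poly R} := if S i then 1 else - Q.
have -> : (fun t : n.-tuple R => \prod_(i < n) (z - (Q.[tnth t i])%:C)) =
    (fun t => \sum_(S : {ffun 'I_n -> bool}) c S * (\prod_i (h S i).[tnth t i])%:C).
  apply/funext => t.
  transitivity (\prod_(i < n) \sum_(b : bool)
      (if b then z else 1) * ((if b then 1 else - Q).[tnth t i])%:C).
    apply: eq_bigr => i _; rewrite big_bool /= hornerC hornerN mulr1 mul1r.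
    by rewrite rmorphN.
  rewrite bigA_distr_bigA; apply: eq_bigr => S _.
  by rewrite rmorph_prod /= -big_split.
rewrite cexpect_sum_prod.
pose M := map_mx (real_complex R) (truncation W e Q n).
have n0 : (n`!%:R : C) != 0 by rewrite pnatr_eq0 -lt0n fact_gt0.
apply: (mulfI n0).
transitivity (n`!%:R * \det (z%:M - M)); last first.
  congr (_ * _); rewrite horner_sum; apply: eq_bigr => s _.
  rewrite hornerM horner_exp !hornerE; congr (_ * _).
  rewrite (big_morph _ (fun p q => hornerM p q z) (hornerC 1 z)).
  by apply: eq_bigr => i _; rewrite !mxE !(hornerE, hornerMn).
rewrite -sum_perm_pair.
transitivity (\sum_(S : {ffun 'I_n -> bool}) c S * (andreief (h S))%:C).
  rewrite mulr_sumr; apply: eq_bigr => S _; rewrite mulrCA; congr (_ * _).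
  by rewrite -(rmorph_nat (real_complex R)) -rmorphM /= mulrA mulfV ?mul1r// pnatr_eq0 -lt0n fact_gt0.
transitivity (\sum_(S : {ffun 'I_n -> bool}) \sum_(st : 'S_n * 'S_n) (-1) ^+ st.1 * (-1) ^+ st.2 *
   \prod_i ((if S i then z else 1) * (L (h S i * e (st.1 i) * e (st.2 i)))%:C)).
  apply: eq_bigr => S _; rewrite /andreief rmorph_sum mulr_sumr; apply: eq_bigr => st _.
  rewrite !rmorphM /= !rmorph_sign rmorph_prod mulrCA; congr (_ * _).
  by rewrite -big_split.
rewrite exchange_big; apply: eq_bigr => st _ /=; rewrite -mulr_sumr; congr (_ * _).
transitivity (\prod_(i < n) \sum_(b : bool) (if b then z else 1) *
   (L ((if b then 1 else - Q) * e (st.1 i) * e (st.2 i)))%:C).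
  by rewrite bigA_distr_bigA; apply: eq_bigr => S _.
apply: eq_bigr => i _; rewrite big_bool /= mul1r mul1r orthonormal !mulNr wintN//.
rewrite !mxE rmorphN /=; congr (_ - _).
by rewrite rmorph_nat mulr_natr.
Qed.

End DeterminantalProcess.

(** * Zeros and moments *)

Lemma zeros_with_mult_monic (R : realType) n (z : 'I_n -> R[i]) (p : {poly R[i]}) :
  p \is monic -> zeros_with_mult (horner p) z ->
  p = \prod_(i < n) ('X - (z i)%:P).
Proof.
move=> pm [c c0 pE]; pose g := \prod_(i < n) ('X - (z i)%:P).
have gm : g \is monic by apply: monic_prod_XsubC.
have pg : p = c *: g.
  apply: (@poly_eq_on_sequence _ (fun j => j%:R)) => [j k|j].
    by move=> /eqP; rewrite eqr_nat => /eqP.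
  rewrite pE hornerZ horner_prod; congr (_ * _).
  by apply: eq_bigr => i _; rewrite !hornerE.
have : lead_coef p = c * lead_coef g by rewrite pg lead_coefZ.
by rewrite (monicP pm) (monicP gm) mulr1 => c1; rewrite pg -c1 scale1r.
Qed.

Lemma map_mx_exp (F G : comNzRingType) (f : {rmorphism F -> G}) n (A : 'M[F]_n) l :
  map_mx f A ^+ l = map_mx f (A ^+ l).
Proof.
elim: l => [|l IHl]; first by rewrite !expr0 map_mx1.
by rewrite !exprS IHl; exact/esym/map_mxM.
Qed.

Lemma cvg_real_complex (R : realType) (u : nat -> R) (v : nat -> R[i]) (a : R) :
  u n @[n --> \oo] --> a -> (forall n, (0 < n)%N -> v n = (u n)%:C) ->
  (fun n => v n - a%:C : R[i]^o) @ \oo --> (0 : R[i]^o).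
Proof.
move=> /cvgrPdist_lt ua vu; apply/cvgrPdist_lt => eps eps0.
have [im0 re0] : complex.Im eps = 0 /\ 0 < complex.Re eps.
  by move: eps0; rewrite ltcE /= => /andP[/eqP -> ->].
near=> n; rewrite sub0r normrN vu; last by near: n; exact: nbhs_infty_gt.
rewrite -rmorphB /= normc_def /= expr0n addr0 sqrtr_sqr.
rewrite ltcE /= im0 eqxx /= distrC; near: n; exact: ua.
Unshelve. all: by end_near. Qed.

(** An f orthogonal to all X k satisfies |f - s|^2 = |f|^2 + |s|^2 for every s in
their span, so density of the span leaves no room for |f| > 0. *)
Lemma complete_orthogonal_null (R : realType) (W : R -> R) (X : nat -> {poly R}) f :
  admissible_weight W -> complete_orthogonal_system W X ->
  (forall k, wint W (f * X k) = 0) -> wint W (f ^+ 2) = 0.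
Proof.
move=> aW [_ _ _ dense] f0.
have wnormE g : wnorm W (horner g) = Num.sqrt (wint W (g ^+ 2)).
  by congr Num.sqrt; apply: eq_int11 => x _; rewrite horner_exp.
have fL2 : in_L2 W (horner f).
  split; first by apply: measurable_oo => x _; exact: continuous_horner_at.
  apply: (@eq_oo_integrable _ (fun x => (f ^+ 2).[x] * W x)) (wintable aW _).
  by move=> x _; rewrite horner_exp.
have F0 := wint_sqr_ge0 aW f.
apply/eqP; apply/negPn/negP => Fn0.
have Fp : 0 < wint W (f ^+ 2) by rewrite lt0r Fn0.
have [n [c]] := dense _ fL2 (Num.sqrt (wint W (f ^+ 2))) (etrans (sqrtr_gt0 _) Fp).
pose s := \sum_(k < n) c k *: X k.
have -> : (fun x : R => f.[x] - \sum_(k < n) c k * (X k).[x]) = horner (f - s).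
  apply/funext => x; rewrite hornerD hornerN horner_sum; congr (_ - _).
  by apply: eq_bigr => k _; rewrite hornerZ.
rewrite wnormE ltNge => /negP; apply; apply: ler_wsqrtr.
have fs : wint W (f * s) = 0.
  rewrite /s mulr_sumr wint_sum//; apply: big1 => k _.
  by rewrite -scalerAr wintZ// f0 mulr0.
have -> : (f - s) ^+ 2 = f ^+ 2 - 2%:R *: (f * s) + s ^+ 2.
  by rewrite scaler_nat; ring.
by rewrite wintD// wintB// wintZ// fs mulr0 subr0 lerDl wint_sqr_ge0.
Qed.

Theorem theorem2 (R : realType) (alpha beta : R)
  (halpha : -1 < alpha) (hbeta : -1 < beta)
  (P : nat -> {poly R}) (hP : forall n, is_jacobi alpha beta n (P n))
  (k : seed) (N : nat) (PN : {poly R})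
  (hPN : is_jacobi (seed_par k alpha beta).1 (seed_par k alpha beta).2 N PN)
  (lam : R)
  (hlam : forall x : R, -1 < x < 1 ->
     jacobi_op alpha beta (seed_fun k alpha beta PN) x
     = lam * seed_fun k alpha beta PN x)
  (s b bw bt : {poly R}) (e1 e2 : int) (m : nat)
  (hs : forall x : R, -1 <= x <= 1 -> s.[x] != 0)
  (hb : b = s * seed_b0 k PN)
  (hb0 : forall x : R, -1 < x < 1 -> b.[x] != 0)
  (hbw : forall x : R, -1 < x < 1 ->
     bw.[x] = b.[x] * (derive1 (seed_fun k alpha beta PN) x
                       / seed_fun k alpha beta PN x))
  (he1 : e1 = 1 \/ e1 = -1) (he2 : e2 = 1 \/ e2 = -1)
  (hbt : b = (1 - 'X) ^+ half_exp e1 * (1 + 'X) ^+ half_exp e2 * bt)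
  (hbt_gt0 : forall x : R, -1 <= x <= 1 -> 0 < bt.[x])
  (hm : size bt = m.+1)
  (hcomplete : complete_orthogonal_system (xweight alpha beta b)
                 (xjacobi alpha beta P b bw))
  (hend : forall n : nat, (xjacobi alpha beta P b bw n).[1] != 0 /\
                          (xjacobi alpha beta P b bw n).[-1] != 0)
  (hbwend : forall a : R, a = 1 \/ a = -1 -> b.[a] = 0 -> bw.[a] != 0)
  (Q : {poly R}) (hQ : deriv Q = bt) (hQ0 : Q.[0] = 0)
  (z y : forall n : nat, 'I_n -> R[i])
  (hz : forall n : nat, (0 < n)%N ->
     zeros_with_mult
       (mod_avg_charpoly (xweight alpha beta b)
          (xjacobi alpha beta P b bw) Q n) (z n))
  (hy : forall (n : nat) (i : 'I_n), chorner Q (y n i) = z n i)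
  (hyreal : forall (n : nat) (i : 'I_n),
     (exists2 x : R, -1 <= x <= 1 & z n i = (Q.[x])%:C) ->
     exists2 x : R, -1 <= x <= 1 & y n i = x%:C)
  (h1 : - (1 / 2) <= alpha + e1%:~R) (h2 : - (1 / 2) <= beta + e2%:~R) :
  forall l : nat,
    (fun n : nat =>
       int_counting (y n) (fun t => chorner Q t ^+ l)
       - (int_equilibrium (fun x => Q.[x] ^+ l))%:C : R[i]^o)
      @ \oo --> (0 : R[i]^o).
Proof.
move=> l.
set W := xweight alpha beta b in hcomplete hz *.
set X := xjacobi alpha beta P b bw in hcomplete hend hz *.
pose phi n := normalize (jacobi_weight alpha beta) (P n).
have XE n : X n = darboux b bw (phi n) by [].
(* When an exponent is lowered, the bound -1/2 forces alpha >= 1/2, resp.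
   beta >= 1/2; positivity is what makes the boundary terms vanish. *)
have hi : half_exp e1 = 0%N \/ half_exp e1 = 1%N /\ 0 < alpha.
  case: he1 => e1E; [left|right; split]; rewrite ?e1E//.
  by move: h1; rewrite e1E mulrN1z => ?; lra.
have hj : half_exp e2 = 0%N \/ half_exp e2 = 1%N /\ 0 < beta.
  case: he2 => e2E; [left|right; split]; rewrite ?e2E//.
  by move: h2; rewrite e2E mulrN1z => ?; lra.
have aw := admissible_jacobi_weight halpha hbeta.
have aW : admissible_weight W := admissible_xweight halpha hbeta hi hj hbt hbt_gt0.
have ric : jac_p R * (bw^`() * b - bw * b^`() + bw ^+ 2) +
    jac_q alpha beta * bw * b = lam *: b ^+ 2.
  apply: (log_derivative_Riccati (phi := seed_fun k alpha beta PN)) => //.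
    by move=> x x11; exact: derivable_seed_fun.
  by move=> x x11; apply: (@seed_fun_neq0 _ _ _ k s PN x x11); rewrite -hb hb0.
have Tphi n : jac_op alpha beta (phi n) = - jac_eig alpha beta n *: phi n.
  by rewrite /phi /normalize jac_opZ (is_jacobi_eigen (hP n)) !scalerA mulrC.
have size_phi n : (size (phi n) <= n.+1)%N.
  exact: leq_trans (size_scale_leq _ _) (size_is_jacobi (hP n)).
have [_ norm0 orth _] := hcomplete.
have norm_gt0 n : 0 < wint W (darboux b bw (phi n) ^+ 2).
  rewrite lt0r wint_sqr_ge0// andbT -XE; apply: contraNneq (norm0 n) => E.
  apply/eqP; rewrite /wnorm -sqrtr0 -E; congr Num.sqrt.
  by apply: eq_int11 => x _; rewrite horner_exp.
have phi1 n : wint (jacobi_weight alpha beta) (phi n ^+ 2) = 1.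
  have N2 : wnorm (jacobi_weight alpha beta) (horner (P n)) ^+ 2 =
      wint (jacobi_weight alpha beta) (P n ^+ 2).
    rewrite /wnorm sqr_sqrtr; first by apply: eq_int11 => x _; rewrite horner_exp.
    by apply: int11_ge0 => x _; rewrite mulr_ge0 ?sqr_ge0 ?jacobi_weight_ge0.
  rewrite /phi /normalize exprZn wintZ// exprVn N2 mulVf// -N2 sqrf_eq0.
  apply: contraTneq (norm_gt0 n) => E.
  by rewrite /phi /normalize E invr0 scale0r /darboux deriv0 !mulr0 subrr expr0n wint0// ltxx.
have orthonormal i j : wint W (normalize W (X i) * normalize W (X j)) = (i == j)%:R.
  have [->|ij] := eqVneq i j.
    by rewrite -expr2 /W (wint_normalize1 halpha hbeta hi hj hbt hbt_gt0 norm_gt0).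
  rewrite /normalize -scalerAr -scalerAl !wintZ//.
  rewrite (_ : wint W (X i * X j) = 0) ?mulr0// -[RHS](orth i j ij).
  by apply: eq_int11 => x _; rewrite hornerM.
have complete f : (forall j, wint W (f * normalize W (X j)) = 0) ->
    wint W (f ^+ 2) = 0.
  move=> f0; apply: (complete_orthogonal_null aW hcomplete) => j.
  move: (f0 j) => /eqP; rewrite /normalize -scalerAr wintZ// mulf_eq0 invr_eq0.
  by rewrite (negbTE (norm0 j)) => /eqP.
have [D band] := normalize_band halpha hbeta hi hj hbt hbt_gt0 ric Tphi size_phi hQ.
have lim := exceptional_equidistribution halpha hbeta hi hj hbt hbt_gt0 ric Tphi
  phi1 norm_gt0 (f := Q ^+ l).
have := cvg_mean_trace aW orthonormal complete band lim.
rewrite (_ : (fun x => Q.[x] ^+ l) = horner (Q ^+ l)); last first.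
  by apply/funext => x; rewrite horner_exp.
move=> /cvg_real_complex; apply => n n0.
(* Both sides are monic, so the constant allowed by the listing of the zeros
   is 1. *)
have mE : char_poly (map_mx (real_complex R)
    (truncation W (fun k => normalize W (X k)) Q n)) =
    \prod_(i < n) ('X - (z n i)%:P).
  apply: zeros_with_mult_monic; first exact: char_poly_monic.
  have [c c0 Hc] := hz n n0; exists c => // t.
  by rewrite -Hc mod_avg_charpoly_char_poly.
rewrite /int_counting rmorphM /= fmorphV rmorph_nat; congr (_ * _).
rewrite -trace_map_mx -map_mx_exp (mxtrace_pow_roots _ mE).
by apply: eq_bigr => i _; rewrite hy.
Qed.
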